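(* Let $n\ge 3$ be an integer. There are constants $c=c(n)$ and $\kappa=\kappa(n)$, depending only on $n$, such that for every integer $d\ge 1$, every projective curve $C\subset\mathbb{P}^n_{\mathbb{Q}}$ of degree $d$ and every real $B\ge 2$ one has $$\#C(\mathbb{Q},B)\le c\,d^{\frac{3(n-1)}{3n-1}}B^2(\log B)^{\kappa}.$$
   Context: A variety in $\mathbb{P}^n_{\mathbb{Q}}$ is a reduced (closed) subscheme of $\mathbb{P}^n_{\mathbb{Q}}$, not necessarily irreducible; a curve is a variety of pure dimension $1$, and its degree is the sum of the degrees of its irreducible components. $C(\mathbb{Q},B)$ denotes the set of rational points of $C$ of height $\le B$, i.e. the points that can be written in homogeneous integer coordinates $(x_0,\dots,x_n)$ (not all zero) with $|x_0|,\dots,|x_n|\le B$. *)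

(* Defs.v *)
From mathcomp Require Import all_boot all_order all_algebra finmap.
From mathcomp Require Import mpoly.
From mathcomp Require Import boolp classical_sets cardinality.

Set Implicit Arguments.
Unset Strict Implicit.
Unset Printing Implicit Defensive.

Import Order.TTheory GRing.Theory Num.Theory.
Local Open Scope ring_scope.

(* A closed subset of P^n_Q is represented by a homogeneous ideal of the
   polynomial ring Q[x_0, ..., x_n]. In ring_quotient, idealr_closed I includes
   1 \notin I, i.e. I is a proper ideal. *)

Definition homog_ideal (n : nat) (I : {pred {mpoly rat[n.+1]}}) : Prop :=
  idealr_closed I /\
  forall p, p \in I -> forall k, pihomog mdeg k p \in I.

(* Reduced closed subschemes of P^n_Q correspond bijectively to the proper
   radical homogeneous ideals; the irrelevant ideal (x_0, ..., x_n) gives the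
   empty scheme. *)
Definition proj_variety (n : nat) (I : {pred {mpoly rat[n.+1]}}) : Prop :=
  homog_ideal I /\ forall p k, p ^+ k \in I -> p \in I.

(* Points of Proj Q[x_0, ..., x_n], equivalently integral closed subschemes. *)
Definition proj_prime (n : nat) (P : {pred {mpoly rat[n.+1]}}) : Prop :=
  [/\ homog_ideal P, prime_idealr_closed P & exists i, 'X_i \notin P].

Definition irreducible_component (n : nat)
    (I P : {pred {mpoly rat[n.+1]}}) : Prop :=
  [/\ proj_prime P, {subset I <= P} &
      forall Q : {pred {mpoly rat[n.+1]}}, proj_prime Q ->
        {subset I <= Q} -> {subset Q <= P} -> {subset P <= Q}].

(* A strict chain of r + 1 integral closed subschemes of V(I); inclusions of
   ideals reverse inclusions of subschemes. *)
Definition irreducible_chain (n : nat) (I : {pred {mpoly rat[n.+1]}})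
    (r : nat) : Prop :=
  exists P : nat -> {pred {mpoly rat[n.+1]}},
    [/\ {subset I <= P 0%N},
        forall i, (i <= r)%N -> proj_prime (P i) &
        forall i, (i < r)%N ->
          {subset P i <= P i.+1} /\ ~ {subset P i.+1 <= P i}].

Definition proj_dim (n : nat) (I : {pred {mpoly rat[n.+1]}}) (r : nat) : Prop :=
  irreducible_chain I r /\ ~ irreducible_chain I r.+1.

Definition proj_curve (n : nat) (I : {pred {mpoly rat[n.+1]}}) : Prop :=
  proj_variety I /\
  forall P : {pred {mpoly rat[n.+1]}},
    irreducible_component I P -> proj_dim P 1.

(* h is the dimension of the degree t part of Q[x_0, ..., x_n] / I. *)
Definition hilbert_function (n : nat) (I : {pred {mpoly rat[n.+1]}})
    (t h : nat) : Prop :=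
  exists2 U : {vspace (dhomog n.+1 rat t)},
    forall p : dhomog n.+1 rat t, (p \in U) = (val p \in I) &
    (h + \dim U)%N = \dim {: dhomog n.+1 rat t}.

Definition hilbert_polynomial (n : nat) (I : {pred {mpoly rat[n.+1]}})
    (H : {poly rat}) : Prop :=
  exists t0 : nat, forall t : nat, (t0 <= t)%N ->
    exists2 h : nat, hilbert_function I t h & H.[t%:R] = h%:R.

(* deg V(P) = r! times the leading coefficient of the Hilbert polynomial, whose
   degree is r = dim V(P). *)
Definition irreducible_degree (n : nat) (P : {pred {mpoly rat[n.+1]}})
    (e : nat) : Prop :=
  exists2 H : {poly rat}, hilbert_polynomial P H &
    e%:R = ((size H).-1)`!%:R * lead_coef H.

Definition curve_degree (n : nat) (I : {pred {mpoly rat[n.+1]}})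
    (d : nat) : Prop :=
  exists (k : nat) (P : 'I_k -> {pred {mpoly rat[n.+1]}}) (e : 'I_k -> nat),
    [/\ forall Q : {pred {mpoly rat[n.+1]}},
          irreducible_component I Q <-> exists i, Q =i P i,
        forall i j, P i =i P j -> i = j,
        forall i, irreducible_degree (P i) (e i) &
        d = (\sum_(i < k) e i)%N].

(* A rational point of P^n is a line in Q^(n+1). *)
Definition rational_points (R : archiRealDomainType) (n : nat)
    (I : {pred {mpoly rat[n.+1]}}) (B : R) : set {vspace 'rV[rat]_n.+1} :=
  [set L | exists x : 'rV[int]_n.+1,
    [/\ x != 0,
        forall i, `|x 0 i|%:~R <= B,
        forall p, p \in I -> p.@[(map_mx intr x : 'rV[rat]_n.+1) 0] = 0 &
        L = <[(map_mx intr x : 'rV[rat]_n.+1)]>%VS]].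

Lemma finite_rational_points (R : archiRealDomainType) (n : nat)
    (I : {pred {mpoly rat[n.+1]}}) (B : R) : finite_set (rational_points I B).
Proof.
pose m := Num.truncn B.
pose x (f : {ffun 'I_n.+1 -> 'I_(2 * m).+1}) : 'rV[int]_n.+1 :=
  \row_i ((f i)%:Z - m%:Z).
pose L f : {vspace 'rV[rat]_n.+1} := <[map_mx intr (x f)]>%VS.
apply: (@sub_finite_set _ _ (range L)%classic).
  move=> _ [y [_ hy _ ->]]; exists [ffun i => inord (absz (y 0%R i + m%:Z)%R)] => //.
  rewrite /L; congr (<[map_mx intr _]>)%VS; apply/rowP => i.
  have : (absz (y 0%R i) <= m)%N.
    have B0 : 0 <= B by apply: le_trans (hy i); rewrite ler0z.
    by rewrite /m truncn_ge_nat // natr_absz.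
  rewrite !mxE ffunE => ym.
  have ym' : `|y 0 i| <= m%:Z by rewrite -abszE lez_nat.
  have {ym'}/andP[h1 h2] : - m%:Z <= y 0 i <= m%:Z by rewrite -ler_norml.
  have h0 : 0 <= y 0 i + m%:Z by rewrite -lerBlDr sub0r.
  rewrite inordK; last first.
    rewrite ltnS -lez_nat gez0_abs // mul2n -addnn PoszD.
    by rewrite lerD2r.
  by rewrite gez0_abs // addrK.
by apply: finite_image; apply: finite_finset.
Qed.

(* fset_set is only meaningful on finite sets, see finite_rational_points. *)
Definition count_rational_points (R : archiRealDomainType) (n : nat)
    (I : {pred {mpoly rat[n.+1]}}) (B : R) : nat :=
  #|` fset_set (rational_points I B)|%fset.

(* Main.v *)
From HB Require Import structures.
Require Import Defs.
From mathcomp Require Import all_boot all_order all_algebra.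
From mathcomp Require Import boolp classical_sets cardinality finmap.
From mathcomp Require Import reals exp.
From mathcomp Require Import ring lra zify.
From mathcomp Require mpoly.

Set Implicit Arguments.
Unset Strict Implicit.
Unset Printing Implicit Defensive.

Import Order.TTheory GRing.Theory Num.Theory.
Local Open Scope ring_scope.

(** Every point of a curve [C] of degree [d] lies on one of its irreducible
    components, whose degrees add up to [d], and a hyperplane that does not
    contain a component of degree [e] meets it in at most [e] points
    ([curve_components]).  Everything else is geometry of numbers.  Write [m]
    for the integral part of [B], and let [V] be the linear span of a component.

    If dim V >= 4 (as a subspace of Q^(n+1)), Siegel's lemma puts every point of
    height at most [m] in [V] on one of about m^(4/3) hyperplanes, so that the
    component has about e * m^(4/3) points.  Adding up gives d * m^(4/3), which
    is at most d^alpha * m^2 as long as d^3 <= m^(3n-1); for larger [d] the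
    total number m^(n+1) of points of the space is already at most
    d^alpha * m^2.  The exponent alpha = 3(n-1)/(3n-1) is the one for which the
    two estimates meet.

    Lines and planes contain more points, but few of them can be dense.  Let
    v_1, ..., v_r be successive minima of the lattice of integral vectors of [V]
    and A the product of their heights.  They form a reduced basis up to bounded
    constants ([reduced_basis]), so [V] has about m^r / A points of height at
    most [m], and if r = 3 Siegel's lemma relative to [V] covers these points by
    about m^(3/2) / A^(1/2) lines of the plane when A <= m^(1/3), and by m^(4/3)
    lines otherwise.  Let delta = d^(1-alpha).
    - For r = 2 a line with A > delta has at most m^2 / delta points, and all
      lines together then have d * m^2 / delta = d^alpha * m^2.
    - For r = 3 the components whose plane has A > delta^2 / m have similarly
      at most d * (m^2 / delta + m^(4/3)) points.
    - The points on lines and planes with A at most the threshold tau are counted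
      by summing m^r / A over all r-tuples of integral vectors:
      since 1 / A <= tau^n / A^(n+1), this is at most m^r * tau^n times the
      r-th power of the sum of |v|^(-n-1) over 0 < |v| <= m, which is a power of
      log m ([height_sum]).  For both thresholds the result is at most
      d^alpha * m^2 times that power; this is where n >= 3 is needed. *)

(** Points of projective space are lines of the vector space, and a line counts as
    soon as one nonzero vector on it satisfies [A]. *)
Definition few_lines (R : numDomainType) N (A : 'rV[rat]_N -> Prop) (b : R) :=
  forall s : seq {vspace 'rV[rat]_N}, uniq s ->
    (forall L, L \in s -> exists x, [/\ x != 0, A x & L = <[x]>%VS]) ->
  (size s)%:R <= b.

(** * Ascending chains of ideals *)
Module Import CurveAlgebra.
Import mpoly.

(** Iterate the choice of an index at which [f] is minimal among the later ones. *)
Lemma nondecreasing_subseq (f : nat -> nat) :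
  exists2 g : nat -> nat, forall i, (g i < g i.+1)%N &
    forall i, (f (g i) <= f (g i.+1))%N.
Proof.
have argmin k : exists i, (k <= i)%N /\ forall j, (k <= j)%N -> (f i <= f j)%N.
  have ex : exists y, `[< exists2 i, (k <= i)%N & f i = y >].
    by exists (f k); apply/asboolP; exists k.
  case: (ex_minnP ex) => y /asboolP[i ki <-] ymin.
  by exists i; split=> // j kj; apply: ymin; apply/asboolP; exists j.
pose a k := sval (cid (argmin k)).
have aP k : (k <= a k)%N /\ forall j, (k <= j)%N -> (f (a k) <= f j)%N.
  exact: svalP (cid (argmin k)).
pose g := fix g i := if i is i'.+1 then a (g i').+1 else a 0%N.
exists g => i; first by case: (aP (g i).+1).
have gi : exists k, g i = a k by case: i => [|i] /=; [exists 0%N|exists (g i).+1].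
have [k gk] := gi; have lt : (g i < g i.+1)%N by case: (aP (g i).+1).
rewrite gk; apply: (aP k).2; apply: leq_trans (aP k).1 _.
by rewrite -gk ltnW.
Qed.

(** Dickson: pass to a subsequence along which one more coordinate is monotone,
    for each coordinate in turn. *)
Lemma dickson n (m : nat -> 'X_{1..n}) :
  exists i j, (i < j)%N /\ (m i <= m j)%MM.
Proof.
have sub k : exists2 g : nat -> nat, forall i, (g i < g i.+1)%N &
    forall (l : 'I_n), (l < k)%N -> forall i, (m (g i) l <= m (g i.+1) l)%N.
  elim: k => [|k [g gS gm]]; first by exists id.
  have [nk|nk] := leqP n k.
    by exists g => // l _; apply: gm; apply: leq_trans (ltn_ord l) nk.
  have [h hS hm] := nondecreasing_subseq (fun i => m (g i) (Ordinal nk)).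
  have ltg := homo_ltn ltn_trans gS.
  exists (g \o h) => [i|l]; first exact: ltg.
  rewrite ltnS leq_eqVlt => /orP[/eqP lk|lk] i /=.
    by rewrite (_ : l = Ordinal nk) //; apply: val_inj.
  apply: (homo_leq (leqnn) (@leq_trans) (gm l lk)); exact: ltnW.
have [g gS gm] := sub n.
exists (g 0%N), (g 1%N); split=> //.
by apply/mnm_lepP => l; apply: gm.
Qed.

Definition submodular n (F : fieldType) (J : {pred {mpoly F[n]}}) :=
  0 \in J /\ forall a, {in J &, forall u v, a * u + v \in J}.

(** If every inclusion were strict, choose in each [J i.+1] outside [J i] a
    polynomial of least leading monomial.  By Dickson one of these monomials
    divides a later one, and cancelling the leading term of the later polynomial
    contradicts its minimality. *)
Lemma ideal_acc n (F : fieldType) (J : nat -> {pred {mpoly F[n]}}) :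
  (forall i, submodular (J i)) ->
  (forall i, {subset J i <= J i.+1}) ->
  exists i, {subset J i.+1 <= J i}.
Proof.
move=> idJ incJ; apply: contrapT => /forallNP strict.
have ex i : exists p, [/\ p \in J i.+1, p \notin J i &
    forall q, (mlead q < mlead p)%O -> q \in J i.+1 -> q \in J i].
  apply: contrapT => /forallNP no; apply: (strict i).
  elim/mleadrect => p IH pJ; apply: contrapT => /negP pJi.
  by apply: (no p); split.
pose p i := sval (cid (ex i)).
have pP i : [/\ p i \in J i.+1, p i \notin J i &
    forall q, (mlead q < mlead (p i))%O -> q \in J i.+1 -> q \in J i].
  exact: svalP (cid (ex i)).
have [i [j [ij le_m]]] := dickson (fun i => mlead (p i)).
have [pi _ _] := pP i; have [pj /negP npj minj] := pP j.
have subJ k l : (k <= l)%N -> {subset J k <= J l}.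
  pose r (A B : {pred {mpoly F[n]}}) := {subset A <= B}.
  apply: (@homo_leq _ J r) => // [A x //|A B C BA AC x /BA/AC //].
have pij : p i \in J j by apply: (subJ i.+1).
have nz k : p k != 0.
  have [_ + _] := pP k; apply: contraNneq => ->; exact: (idJ k).1.
have nzX m : 'X_[m] != 0 :> {mpoly F[n]}.
  by rewrite -msize_poly_eq0 msizeX.
(* [r] is the multiple of [p i] with the leading monomial of [p j]. *)
pose u := (mlead (p j) - mlead (p i))%MM.
pose c := mleadc (p j) / mleadc (p i).
pose r := 'X_[u] * p i.
have rl : mlead r = mlead (p j).
  by rewrite mleadM ?nz ?nzX // mleadXm submK.
have rc : r@_(mlead (p j)) = mleadc (p i).
  by rewrite -rl /r mleadM ?nz ?mpolyX_eq0 // mleadXm mulrC mcoeffMX.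
pose q := p j - c *: r.
have qJ K : K \in [:: j; j.+1] -> (q \in J K) = (p j \in J K).
  move=> Kj.
  have rK : r \in J K.
    have piK : p i \in J K.
      by move: Kj; rewrite !inE => /orP[]/eqP-> //; apply: incJ.
    by have := (idJ K).2 'X_[u] _ _ piK (idJ K).1; rewrite addr0.
  apply/idP/idP => h.
    have := (idJ K).2 c%:MP _ _ rK h.
    by rewrite mul_mpolyC /q addrC subrK.
  have := (idJ K).2 (- c)%:MP _ _ rK h.
  by rewrite mul_mpolyC scaleNr addrC.
apply: npj; rewrite -qJ ?inE ?eqxx //.
have [->|nq] := eqVneq q 0; first exact: (idJ j).1.
apply: minj; last by rewrite qJ // !inE eqxx orbT.
rewrite lt_neqAle; apply/andP; split.
  apply: contraNneq nq => ql; rewrite -mleadc_eq0 ql.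
  by rewrite mcoeffB mcoeffZ rc divfK ?subrr // mleadc_eq0.
apply: le_trans (mleadB_le _ _) _; rewrite leUx lexx /=.
by apply: le_trans (mleadZ_le _ _) _; rewrite rl.
Qed.

(** Noetherian induction: an endless choice of larger ideals satisfying [Phi]
    would contradict the ascending chain condition. *)
Lemma ideal_maximal n (F : fieldType) (Phi : {pred {mpoly F[n]}} -> Prop) J :
  (forall K, Phi K -> submodular K) -> Phi J ->
  exists K, [/\ Phi K, {subset J <= K} &
    forall L, Phi L -> {subset K <= L} -> {subset L <= K}].
Proof.
move=> idP PJ; apply: contrapT => /forallNP no.
pose T := {K | Phi K /\ {subset J <= K}}.
have step (K : T) : {L : T | {subset sval K <= sval L} /\
    ~ {subset sval L <= sval K}}.
  case: K => K [PK JK]; apply: cid => /=.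
  apply: contrapT => /forallNP noL; apply: (no K); split=> // L PL KL.
  apply: contrapT => LK.
  have JL : {subset J <= L} by move=> x /JK/KL.
  exact: (noL (exist _ L (conj PL JL))).
pose K0 : T := exist _ J (conj PJ (fun x h => h)).
pose K i := iter i (fun K => sval (step K)) K0.
have KS i : {subset sval (K i) <= sval (K i.+1)} /\
    ~ {subset sval (K i.+1) <= sval (K i)}.
  exact: svalP (step (K i)).
have [i] := ideal_acc (J := fun i => sval (K i))
  (fun i => idP _ (svalP (K i)).1) (fun i => (KS i).1).
exact: (KS i).2.
Qed.

(** * Hilbert functions of homogeneous ideals *)

(** A linearly closed predicate is a subspace: take a subspace inside it of
    largest dimension. *)
Lemma vspace_of_closed (F : fieldType) (vT : vectType F) (A : {pred vT}) :
  0 \in A -> (forall a, {in A &, forall u v, a *: u + v \in A}) ->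
  exists U : {vspace vT}, forall x, (x \in U) = (x \in A).
Proof.
move=> A0 AD.
pose ok k := `[< exists2 U : {vspace vT}, {subset U <= A} & \dim U = k >].
have ex : exists k, ok k.
  exists 0%N; apply/asboolP; exists 0%VS; last by rewrite dimv0.
  by move=> x; rewrite memv0 => /eqP->.
have bd k : ok k -> (k <= \dim {:vT})%N.
  by move=> /asboolP[U _ <-]; apply: dimvS; apply: subvf.
case: (ex_maxnP ex bd) => k /asboolP[U UA dU] kmax.
exists U => x; apply/idP/idP => [/UA //|xA].
have okx : ok (\dim (U + <[x]>)%VS).
  apply/asboolP; exists (U + <[x]>)%VS => // y /memv_addP[u uU [w]].
  by move=> /vlineP[a ->] ->; rewrite addrC AD // UA.
have := kmax _ okx; rewrite -dU => le.
have /eqP -> : U == (U + <[x]>)%VS by rewrite eqEdim addvSl le.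
by apply: (subvP (addvSr U <[x]>)); exact: memv_line.
Qed.

Notation mpolyQ n := {mpoly rat[n.+1]}.

(** The improper ideal is allowed, so that sums and colons of homogeneous ideals
    stay in the class. *)
Definition hideal n (J : {pred mpolyQ n}) : Prop :=
  submodular J /\ forall p, p \in J -> forall k, pihomog mdeg k p \in J.

Section Ideal.
Variables (n : nat) (J : {pred mpolyQ n}).
Hypothesis hJ : hideal J.

Lemma hideal0 : 0 \in J. Proof. by case: hJ => -[]. Qed.

Lemma hidealD u v : u \in J -> v \in J -> u + v \in J.
Proof. by case: hJ => -[_ h] _ uJ vJ; rewrite -[u]mul1r h. Qed.

Lemma hidealM a u : u \in J -> a * u \in J.
Proof. by case: hJ => -[h0 h] _ uJ; rewrite -[_ * _]addr0 h. Qed.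

Lemma hidealMr a u : u \in J -> u * a \in J.
Proof. by rewrite mulrC; exact: hidealM. Qed.

Lemma hidealN u : u \in J -> - u \in J.
Proof. by rewrite -mulN1r; exact: hidealM. Qed.

Lemma hidealB u v : u \in J -> v \in J -> u - v \in J.
Proof. by move=> uJ vJ; rewrite hidealD // hidealN. Qed.

Lemma hidealZ c u : u \in J -> c *: u \in J.
Proof. by rewrite -mul_mpolyC; exact: hidealM. Qed.

Lemma hideal_pihomog k p : p \in J -> pihomog mdeg k p \in J.
Proof. by case: hJ => _ h pJ; apply: h. Qed.

Lemma hideal_sum I (r : seq I) (Q : pred I) f :
  (forall i, Q i -> f i \in J) -> \sum_(i <- r | Q i) f i \in J.
Proof.
move=> fJ; apply: (big_ind (fun u => u \in J)) => //; first exact: hideal0.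
exact: hidealD.
Qed.

Lemma hideal_subl u v : v \in J -> (u - v \in J) = (u \in J).
Proof.
move=> vJ; apply/idP/idP => [h|h]; last exact: hidealB.
by rewrite -(subrK v u) hidealD.
Qed.

Lemma degpart_ex t : exists U : {vspace (dhomog n.+1 rat t)},
  forall p : dhomog n.+1 rat t, (p \in U) = (val p \in J).
Proof.
have [| |U UP] := @vspace_of_closed _ (dhomog n.+1 rat t) [pred p | val p \in J].
- by rewrite inE; exact: hideal0.
- by move=> a u v uJ vJ; rewrite inE linearP /= hidealD // hidealZ.
by exists U => p; rewrite UP.
Qed.

End Ideal.

Lemma homog_idealW n (J : {pred mpolyQ n}) : homog_ideal J -> hideal J.
Proof. by move=> [[h0 _ h] hc]; split. Qed.

Definition degpart n (J : {pred mpolyQ n}) t : {vspace (dhomog n.+1 rat t)} :=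
  xget 0%VS (fun U : {vspace (dhomog n.+1 rat t)} =>
    forall p, (p \in U) = (val p \in J)).

Lemma degpartP n (J : {pred mpolyQ n}) t : hideal J ->
  forall p, (p \in degpart J t) = (val p \in J).
Proof.
move=> hJ; have [U UP] := degpart_ex hJ t.
exact: (@xgetPex _ 0%VS (fun U : {vspace (dhomog n.+1 rat t)} =>
  forall p, (p \in U) = (val p \in J)) (ex_intro _ U UP)).
Qed.

(** The Hilbert function of S/J. *)
Definition hf n (J : {pred mpolyQ n}) t : nat :=
  (\dim {: dhomog n.+1 rat t} - \dim (degpart J t))%N.

Lemma hfK n (J : {pred mpolyQ n}) t :
  (hf J t + \dim (degpart J t))%N = \dim {: dhomog n.+1 rat t}.
Proof. by rewrite subnK // dimvS // subvf. Qed.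

Lemma hilbert_functionE n (J : {pred mpolyQ n}) t h : hideal J ->
  hilbert_function J t h -> h = hf J t.
Proof.
move=> hJ [U UP eqh]; apply: (@addIn (\dim U)); rewrite eqh.
have -> : U = degpart J t by apply/vspaceP => p; rewrite UP degpartP.
by rewrite hfK.
Qed.

Definition add_ideal n (J : {pred mpolyQ n}) a : {pred mpolyQ n} :=
  [pred p | `[< exists q, p - q * a \in J >]].

Definition colon n (J : {pred mpolyQ n}) a : {pred mpolyQ n} :=
  [pred p | p * a \in J].

Lemma add_idealP n (J : {pred mpolyQ n}) a p :
  reflect (exists q, p - q * a \in J) (p \in add_ideal J a).
Proof. exact: asboolP. Qed.

Lemma pihomogM n (p a : mpolyQ n) k t : a \is k.-homog ->
  pihomog mdeg (t + k) (p * a) = pihomog mdeg t p * a.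
Proof.
move=> ha; pose m := maxn (msize p) t.+1.
have pm : (msize p <= m)%N by rewrite leq_maxl.
have tm : (t < m)%N by rewrite leq_maxr.
rewrite {1}(pihomog_partitionE pm) mulr_suml raddf_sum /=.
rewrite (bigD1 (Ordinal tm)) //= big1 ?addr0.
  by apply: pihomog_dE; apply: dhomogM => //; apply: pihomogP.
move=> i /eqP ne; apply: (@pihomog_ne0 _ _ mdeg (i + k)%N).
  by rewrite eqn_add2r; apply/eqP => e; apply: ne; apply: val_inj.
by apply: dhomogM => //; apply: pihomogP.
Qed.

Lemma pihomogM_lt n (p a : mpolyQ n) k t : a \is k.-homog -> (t < k)%N ->
  pihomog mdeg t (p * a) = 0.
Proof.
move=> ha tk; rewrite {1}(pihomog_partitionE (leqnn (msize p))).
rewrite mulr_suml raddf_sum /= big1 // => i _.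
apply: (@pihomog_ne0 _ _ mdeg (i + k)%N).
  by rewrite neq_ltn ltn_addl ?orbT.
by apply: dhomogM => //; apply: pihomogP.
Qed.

Lemma hideal_colon n (J : {pred mpolyQ n}) a k : hideal J -> a \is k.-homog ->
  hideal (colon J a).
Proof.
move=> hJ ha; split; first split; rewrite ?inE.
- by rewrite mul0r hideal0.
- by move=> b u v; rewrite !inE mulrDl -mulrA => uJ vJ; apply: hidealD => //; apply: hidealM.
by move=> p; rewrite !inE => pJ t; rewrite inE -(pihomogM _ _ ha); apply: hideal_pihomog.
Qed.

Lemma hideal_add n (J : {pred mpolyQ n}) a k : hideal J -> a \is k.-homog ->
  hideal (add_ideal J a).
Proof.
move=> hJ ha; split; first split.
- by apply/add_idealP; exists 0; rewrite mul0r subr0 hideal0.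
- move=> b u v /add_idealP[q qJ] /add_idealP[r rJ]; apply/add_idealP.
  exists (b * q + r).
  have -> : b * u + v - (b * q + r) * a = b * (u - q * a) + (v - r * a) by ring.
  by apply: hidealD => //; apply: hidealM.
move=> p /add_idealP[q qJ] t; apply/add_idealP.
have := hideal_pihomog hJ t qJ; rewrite raddfB /=.
have [tk|kt] := ltnP t k.
  by rewrite (pihomogM_lt _ ha) // subr0 => h; exists 0; rewrite mul0r subr0.
rewrite -{2}(subnK kt) (pihomogM _ _ ha) => h.
by exists (pihomog mdeg (t - k) q).
Qed.

Lemma sub_add_ideal n (J : {pred mpolyQ n}) a : {subset J <= add_ideal J a}.
Proof. by move=> p pJ; apply/add_idealP; exists 0; rewrite mul0r subr0. Qed.

Lemma gen_add_ideal n (J : {pred mpolyQ n}) a : hideal J -> a \in add_ideal J a.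
Proof.
by move=> hJ; apply/add_idealP; exists 1; rewrite mul1r subrr hideal0.
Qed.

(** The dimensions in degree [t + k] of the exact sequence
    0 -> S/(J:a) -> S/J -> S/(J+a) -> 0, whose first map is multiplication by
    [a]. *)
Lemma hf_exact n (J : {pred mpolyQ n}) a k t : hideal J -> a \is k.-homog ->
  hf J (t + k) = (hf (add_ideal J a) (t + k) + hf (colon J a) t)%N.
Proof.
move=> hJ ha.
have hA := hideal_add hJ ha; have hC := hideal_colon hJ ha.
have vM (q : dhomog n.+1 rat t) : val q * a \is (t + k).-homog by
  apply: dhomogM => //; apply: dhomog_is_dhomog.
pose m (q : dhomog n.+1 rat t) : dhomog n.+1 rat (t + k) := DHomog (vM q).
have m_lin : linear m.
  move=> c p q; apply: val_inj => /=.
  by rewrite mulrDl scalerAl.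
pose mL : {linear dhomog n.+1 rat t -> dhomog n.+1 rat (t + k)} := HB.pack m
  (GRing.isLinear.Build _ _ _ _ m m_lin).
pose f := linfun mL.
have fE q : val (f q) = val q * a by rewrite lfunE.
have eC : (f @^-1: degpart J (t + k))%VS = degpart (colon J a) t.
  apply/vspaceP => q; rewrite -memv_preim !degpartP // fE.
  by rewrite inE.
have eA : (limg f + degpart J (t + k))%VS = degpart (add_ideal J a) (t + k).
  apply/vspaceP => p; rewrite degpartP //; apply/idP/idP.
    move=> /memv_addP[_ /memv_imgP[q _ ->]] [r rJ ->].
    apply/add_idealP; exists (val q).
    have -> : val (f q + r) = val q * a + val r by rewrite -fE.
    by rewrite addrC addKr -degpartP.
  move=> /add_idealP[q qJ]; apply/memv_addP.
  pose q' : dhomog n.+1 rat t := DHomog (pihomogP mdeg t q).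
  exists (f q'); first exact: memv_img (memvf _).
  exists (p - f q'); last by rewrite addrC subrK.
  rewrite degpartP //.
  have -> : val (p - f q') = val p - val q' * a by rewrite -fE.
  have := hideal_pihomog hJ (t + k) qJ.
  by rewrite raddfB /= (pihomogM _ _ ha) (pihomog_dE (dhomog_is_dhomog p)).
have d1 := limg_ker_dim f (degpart (colon J a) t).
have d2 := limg_ker_dim f {: dhomog n.+1 rat t}.
have eI : (f @: degpart (colon J a) t)%VS = (limg f :&: degpart J (t + k))%VS.
  by rewrite -eC -lpreim_cap_limg lpreimK ?capvSr // capvC.
have kerC : (lker f <= degpart (colon J a) t)%VS.
  by rewrite -eC; apply/subvP => q; rewrite memv_ker => /eqP fq;
    rewrite -memv_preim fq mem0v.
have := dimv_sum_cap (limg f) (degpart J (t + k)).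
rewrite eA -eI; move: d1 d2; rewrite (capv_idPr kerC) capfv.
have := hfK J (t + k); have := hfK (add_ideal J a) (t + k).
have := hfK (colon J a) t.
move: (\dim (degpart (colon J a) t)) (\dim (degpart J (t + k)))
  (\dim (degpart (add_ideal J a) (t + k))) (\dim (limg f)) => dC dJ dA dL.
move: (\dim (f @: _)) (\dim (lker f)) => dI dK hC1 hA1 hJ1 e1 e2 e3.
have e4 : (hf J (t + k) + dJ = hf (add_ideal J a) (t + k) + dA)%N by rewrite hJ1.
have e5 : (hf (colon J a) t + dC = dK + dL)%N by rewrite hC1.
lia.
Qed.

(** * Homogeneous primes and chains of subvarieties *)
Lemma dhomogU n (i : 'I_n.+1) : ('X_i : mpolyQ n) \is 1.-homog.
Proof. by rewrite dhomogX; apply/eqP; exact: mdeg1. Qed.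

Lemma pihomog_ge_msize n (p : mpolyQ n) t : (msize p <= t)%N ->
  pihomog mdeg t p = 0.
Proof.
move=> pt; rewrite {1}(pihomog_partitionE (leqnn (msize p))) raddf_sum big1 //= => i _.
apply: (@pihomog_ne0 _ _ mdeg i); last exact: pihomogP.
by rewrite ltn_eqF // (leq_trans (ltn_ord i)).
Qed.

Lemma pihomogM_top n (u v : mpolyQ n) a b :
  (msize u <= a.+1)%N -> (msize v <= b.+1)%N ->
  pihomog mdeg (b + a) (u * v) = pihomog mdeg a u * pihomog mdeg b v.
Proof.
move=> ua vb; rewrite {1}(pihomog_partitionE ua) mulr_suml raddf_sum /=.
have e (i : 'I_a.+1) : (b + a = (b + (a - i)) + i)%N.
  by rewrite -addnA subnK // -ltnS.
rewrite (bigD1 ord_max) //= big1 ?addr0 => [|i ne].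
  by rewrite mulrC (pihomogM _ _ (pihomogP mdeg a u)) mulrC.
rewrite (e i) mulrC (pihomogM _ _ (pihomogP mdeg i u)).
rewrite pihomog_ge_msize ?mul0r // (leq_trans vb) // -addn1 leq_add2l subn_gt0.
by rewrite ltn_neqAle ne -ltnS ltn_ord.
Qed.

Lemma msize_sub_top n (u : mpolyQ n) a : msize u = a.+1 ->
  (msize (u - pihomog mdeg a u) < msize u)%N.
Proof.
move=> ua; rewrite ua ltnS {1}(pihomog_partitionE (eq_leq ua)).
rewrite big_ord_recr /= addrK; apply: (leq_trans (msize_sum _ _ _)).
apply/bigmax_leqP => i _; apply: leq_trans (ltn_ord i).
rewrite msizeE; apply/bigmax_leqP_seq => m mi _.
by rewrite ltnS (dhomog_mf (pihomogP mdeg i u) mi).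
Qed.

(** Primality of a homogeneous ideal can be tested on forms: if [u * v] is in
    [J], so is the product of the top components of [u] and [v], and one of these
    components can be removed. *)
Lemma prime_homogP n (J : {pred mpolyQ n}) : hideal J ->
  (forall a b k l, a \is k.-homog -> b \is l.-homog -> a * b \in J ->
     (a \in J) || (b \in J)) ->
  prime_idealr_closed J.
Proof.
move=> hJ prJ u v; have [m] := ubnP (msize u + msize v).
elim: m u v => // m IH u v; rewrite ltnS => le uv.
have [->|nu] := eqVneq u 0; first by rewrite hideal0.
have [->|nv] := eqVneq v 0; first by rewrite hideal0 ?orbT.
have ua : msize u = (msize u).-1.+1 by rewrite prednK // lt0n msize_poly_eq0.
have vb : msize v = (msize v).-1.+1 by rewrite prednK // lt0n msize_poly_eq0.
have := hideal_pihomog hJ ((msize v).-1 + (msize u).-1) uv.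
rewrite (pihomogM_top (eq_leq ua) (eq_leq vb)).
move=> /(prJ _ _ _ _ (pihomogP mdeg _ u) (pihomogP mdeg _ v))/orP[tJ|tJ].
  have : (u - pihomog mdeg (msize u).-1 u) * v \in J.
    by rewrite mulrBl hidealB // hidealMr.
  move/IH; rewrite hideal_subl //; apply.
  by apply: leq_trans le; rewrite ltn_add2r msize_sub_top.
have : u * (v - pihomog mdeg (msize v).-1 v) \in J.
  by rewrite mulrBr hidealB // hidealM.
move/IH; rewrite hideal_subl //; apply.
by apply: leq_trans le; rewrite ltn_add2l msize_sub_top.
Qed.

Lemma hf_eq0 n (J : {pred mpolyQ n}) t : hideal J ->
  (forall p, p \is t.-homog -> p \in J) -> hf J t = 0%N.
Proof.
move=> hJ all; rewrite /hf; suff -> : degpart J t = fullv by rewrite subnn.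
apply/vspaceP => p; rewrite degpartP // memvf; apply/idP; apply: all.
exact: dhomog_is_dhomog.
Qed.

Lemma hf_eq0_in n (J : {pred mpolyQ n}) t : hideal J -> hf J t = 0%N ->
  forall p, p \is t.-homog -> p \in J.
Proof.
move=> hJ h0 p hp; have := hfK J t; rewrite h0 add0n => e.
have /eqP eV : degpart J t == fullv by rewrite eqEdim subvf e leqnn.
by have := memvf (DHomog hp); rewrite -eV degpartP.
Qed.

Lemma eq_hf n (J K : {pred mpolyQ n}) t : hideal J -> hideal K -> J =i K ->
  hf J t = hf K t.
Proof.
move=> hJ hK e; rewrite /hf; congr (_ - \dim _)%N.
by apply/vspaceP => p; rewrite !degpartP.
Qed.

Lemma irrelevant_hf n (J : {pred mpolyQ n}) t : hideal J ->
  (forall i, 'X_i \in J) -> (0 < t)%N -> hf J t = 0%N.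
Proof.
move=> hJ XJ t0; apply: hf_eq0 => // p hp; rewrite [p]mpolyE.
rewrite big_seq; apply: hideal_sum => // m mp; apply: hidealZ => //.
have mt : mdeg m = t := dhomog_mf hp mp.
have [i mi] : exists i, (0 < m i)%N.
  apply: contrapT => /forallNP h; move: t0; rewrite -mt mdegE big1 // => i _.
  by apply/eqP; rewrite -leqn0 leqNgt; apply/negP/h.
have -> : m = (U_(i) + (m - U_(i)))%MM.
  rewrite addmC submK //; apply/mnm_lepP => j; rewrite mnm1E.
  by case: eqP => // <-.
by rewrite mpolyXD hidealMr.
Qed.

(** A variable outside [P] has all its powers outside [P]. *)
Lemma hf_prime_gt0 n (P : {pred mpolyQ n}) t : proj_prime P -> (0 < hf P t)%N.
Proof.
move=> [/homog_idealW hP pP [i Xi]]; rewrite lt0n; apply: contraNneq Xi => h0.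
have : 'X_i ^+ t \in P.
  apply: (hf_eq0_in hP h0); rewrite -[X in X.-homog]mul1n.
  by apply: dhomogMn; exact: dhomogU.
elim: t {h0} => [|t IH]; rewrite ?expr0.
  by move=> h; rewrite -['X_i]mulr1 hidealM.
by rewrite exprS => /pP/orP[//|].
Qed.

(** Existence of primes containing [J]: an ideal that is maximal for a largeness
    property inherited by [K + a] or [K : a] is prime, because for [a * b] in
    [Q] with [a] outside [Q] the ideal [Q + a] is not large, hence [Q : a] is, so
    that [b], which it contains, is in [Q]. *)
Lemma prime_of_large n (large : {pred mpolyQ n} -> Prop) (J : {pred mpolyQ n}) :
  (forall K a k, hideal K -> a \is k.-homog -> large K ->
     large (add_ideal K a) \/ large (colon K a)) ->
  (forall K, hideal K -> large K -> exists2 t, (0 < t)%N & hf K t <> 0%N) ->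
  hideal J -> large J ->
  exists Q, [/\ proj_prime Q, {subset J <= Q} & large Q].
Proof.
move=> split_large large_hf hJ lJ.
have [||Q [[hQ lQ] JQ maxQ]] :=
    @ideal_maximal _ _ (fun K => hideal K /\ large K) J.
- by move=> K [[]].
- by [].
have [t t0 ht] := large_hf Q hQ lQ.
exists Q; split=> //; split.
- split; last by move=> p pQ k; apply: hideal_pihomog.
  split; [exact: hideal0 | | by case: hQ => -[]].
  apply/negP => Q1; apply: ht; apply: hf_eq0 => // p _.
  by rewrite -[p]mulr1 hidealM.
- apply: prime_homogP => // a b k l ha hb ab; apply/orP.
  have [lA|lC] := split_large Q a k hQ ha lQ.
    left; apply: (maxQ (add_ideal Q a)); last exact: gen_add_ideal.
      by split=> //; apply: hideal_add ha.
    exact: sub_add_ideal.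
  right; apply: (maxQ (colon Q a)); last by rewrite inE mulrC.
    by split=> //; apply: hideal_colon ha.
  by move=> p pQ; rewrite inE hidealMr.
apply: contrapT => /forallNP h; apply: ht; apply: irrelevant_hf => // i.
by apply: contrapT => /negP; apply: h.
Qed.

Definition hf_unbounded n (J : {pred mpolyQ n}) := forall M, exists t, (M < hf J t)%N.

Definition hf_recurrent n (J : {pred mpolyQ n}) :=
  forall t0, exists2 t, (t0 <= t)%N & hf J t <> 0%N.

Lemma hf_boundedP n (J : {pred mpolyQ n}) :
  ~ hf_unbounded J -> exists M, forall t, (hf J t <= M)%N.
Proof.
move=> /existsNP[M /forallNP h]; exists M => t.
by rewrite leqNgt; apply/negP/h.
Qed.

Lemma hf_vanishP n (J : {pred mpolyQ n}) :
  ~ hf_recurrent J -> exists t0, forall t, (t0 <= t)%N -> hf J t = 0%N.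
Proof.
move=> /existsNP[t0 h]; exists t0 => t tt0; apply: contrapT => ne.
by apply: h; exists t.
Qed.

Lemma prime_of_unbounded n (J : {pred mpolyQ n}) : hideal J -> hf_unbounded J ->
  exists Q, [/\ proj_prime Q, {subset J <= Q} & hf_unbounded Q].
Proof.
apply: prime_of_large => [K a k hK ha uK|K hK uK].
  apply: contrapT => /not_orP[/hf_boundedP[M1 b1] /hf_boundedP[M2 b2]].
  have [t] := uK (M1 + M2 + \max_(t < k) hf K t)%N; apply/negP; rewrite -leqNgt.
  have [tk|kt] := ltnP t k.
    rewrite (leq_trans _ (leq_addl _ _)) //.
    exact: (@leq_bigmax _ (fun i => hf K (val i)) (Ordinal tk)).
  rewrite -(subnK kt) (hf_exact _ hK ha) (leq_trans _ (leq_addr _ _)) //.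
  exact: leq_add.
have [t ht] := uK (hf K 0%N).
by exists t; [case: t ht => //; rewrite ltnn | case: (hf K t) ht].
Qed.

Lemma prime_of_recurrent n (J : {pred mpolyQ n}) : hideal J -> hf_recurrent J ->
  exists Q, [/\ proj_prime Q, {subset J <= Q} & hf_recurrent Q].
Proof.
apply: prime_of_large => [K a k hK ha rK|K hK rK]; last exact: rK 1%N.
apply: contrapT => /not_orP[/hf_vanishP[t1 z1] /hf_vanishP[t2 z2]].
have [t tt] := rK (t1 + t2 + k)%N; apply.
have kt : (k <= t)%N by lia.
rewrite -(subnK kt) (hf_exact _ hK ha) z1 ?z2 //; lia.
Qed.

(** For a prime [P] that does not contain [F], [P : F] is [P] itself. *)
Lemma hf_hyperplane n (P : {pred mpolyQ n}) F t : proj_prime P ->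
  F \is 1.-homog -> F \notin P ->
  hf P t.+1 = (hf (add_ideal P F) t.+1 + hf P t)%N.
Proof.
move=> [/homog_idealW hP pP _] hF FP; rewrite -addn1 (hf_exact _ hP hF).
congr (_ + _)%N; apply: eq_hf => //; first exact: hideal_colon hF.
move=> p; rewrite inE; apply/idP/idP => [/pP|]; first by rewrite (negPf FP) orbF.
exact: hidealMr.
Qed.

(** A variety with a hyperplane section of unbounded Hilbert function has
    dimension at least two: there is a prime over [P + F] with unbounded Hilbert
    function, and cutting once more leaves a Hilbert function that does not
    vanish eventually, hence a further prime. *)
Lemma chain_of_unbounded n (P : {pred mpolyQ n}) F : proj_prime P ->
  F \is 1.-homog -> F \notin P -> hf_unbounded (add_ideal P F) ->
  irreducible_chain P 2.
Proof.
move=> pP hF FP uA.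
have hP : hideal P by case: pP => /homog_idealW.
have [Q1 [pQ1 AQ1 uQ1]] := prime_of_unbounded (hideal_add hP hF) uA.
have hQ1 : hideal Q1 by case: pQ1 => /homog_idealW.
have [i Xi] : exists i, 'X_i \notin Q1 by case: pQ1.
have hX : ('X_i : mpolyQ n) \is 1.-homog := dhomogU i.

have rA : hf_recurrent (add_ideal Q1 'X_i).
  apply: contrapT => /hf_vanishP[t0 z].
  have [t] := uQ1 (\max_(t < t0.+1) hf Q1 t)%N; apply/negP; rewrite -leqNgt.
  have [lt|ge] := ltnP t t0.+1.
    exact: (@leq_bigmax _ (fun i => hf Q1 (val i)) (Ordinal lt)).
  have -> : hf Q1 t = hf Q1 t0.
    rewrite -(subnKC (ltnW ge)); elim: (t - t0)%N => [|s IH]; rewrite ?addn0 //.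
    by rewrite addnS (hf_hyperplane _ pQ1 hX Xi) z ?IH // -addnS leq_addr.
  exact: (@leq_bigmax _ (fun i => hf Q1 (val i)) (Ordinal (ltnSn t0))).
have [Q2 [pQ2 AQ2 _]] := prime_of_recurrent (hideal_add hQ1 hX) rA.
exists (fun k => if k is k'.+1 then if k' is _.+1 then Q2 else Q1 else P).
split=> // [[|[|[|//]]]//|[|[|//]] _]; split.
- by move=> p /(sub_add_ideal F)/AQ1.
- by move=> h; move: FP; rewrite h ?AQ1 ?gen_add_ideal.
- by move=> p /(sub_add_ideal 'X_i)/AQ2.
- by move=> h; move: Xi; rewrite h ?AQ2 ?gen_add_ideal.
Qed.

(** * Hyperplane sections of curves *)
Definition in_zeros n (J : {pred mpolyQ n}) (x : 'rV[rat]_n.+1) :=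
  forall p, p \in J -> p.@[x 0] = 0.

(** Some 2 x 2 minor of the coordinates of [x] and [y] does not vanish. *)
Lemma line_separation n (x y : 'rV[rat]_n.+1) : x != 0 -> y != 0 ->
  <[x]>%VS != <[y]>%VS -> exists F : mpolyQ n,
  [/\ F \is 1.-homog, F.@[y 0] = 0 & F.@[x 0] != 0].
Proof.
move=> nx ny ne; have /rV0Pn[j yj] := ny.
have [i h] : exists i, x 0 i * y 0 j - x 0 j * y 0 i != 0.
  apply: contrapT => /forallNP h; move/negP: ne; apply.
  have e : x = (x 0 j / y 0 j) *: y.
    apply/rowP => i; rewrite mxE.
    have /negP := h i; rewrite negbK subr_eq0 => /eqP e.
    by rewrite mulrAC -e mulfK.
  have nj : x 0 j / y 0 j != 0.
    by apply: contraNneq nx => e0; rewrite e e0 scale0r.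
  rewrite {1}e; apply/eqP/vspaceP => z; apply/idP/idP => /vlineP[k ->].
    by rewrite scalerA; apply/vlineP; exists (k * (x 0 j / y 0 j)).
  by apply/vlineP; exists (k / (x 0 j / y 0 j)); rewrite scalerA divfK.
exists (y 0 j *: 'X_i - y 0 i *: 'X_j); split.
- by rewrite rpredB // rpredZ // dhomogU.
- by rewrite mevalB !mevalZ !mevalXU mulrC subrr.
by rewrite mevalB !mevalZ !mevalXU mulrC [y 0 i * _]mulrC.
Qed.

Lemma dhomog_prod1 n I (r : seq I) (f : I -> mpolyQ n) :
  (forall i, f i \is 1.-homog) -> \prod_(i <- r) f i \is (size r).-homog.
Proof.
move=> hf; elim: r => [|i r IH]; first by rewrite big_nil; exact: dhomog1.
by rewrite big_cons; exact: (dhomogM (hf i) IH).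
Qed.

(** Distinct points impose independent conditions on forms of large degree: for
    each point a product of linear forms vanishes at the others only, so that
    evaluation at the points is onto, and it kills [J]. *)
Lemma points_le_hf n (J : {pred mpolyQ n}) k (x : 'I_k -> 'rV[rat]_n.+1) t :
  hideal J -> (forall i, x i != 0) ->
  (forall i j, i != j -> <[x i]>%VS != <[x j]>%VS) ->
  (forall i, in_zeros J (x i)) -> (k <= t)%N -> (k <= hf J t)%N.
Proof.
move=> hJ nx dx zx kt.
pose ev (p : dhomog n.+1 rat t) : 'rV[rat]_k := \row_i (val p).@[x i 0].
have ev_lin : linear ev.
  by move=> c p q; apply/rowP => i; rewrite !mxE /= mevalD mevalZ.
pose evL : {linear dhomog n.+1 rat t -> 'rV[rat]_k} :=
  HB.pack ev (GRing.isLinear.Build _ _ _ _ ev ev_lin).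
pose f := linfun evL.
have fE p : f p = \row_i (val p).@[x i 0] by rewrite lfunE.
have ker : (degpart J t <= lker f)%VS.
  apply/subvP => p; rewrite degpartP // memv_ker => pJ; apply/eqP/rowP => i.
  by rewrite fE !mxE; apply: zx.
have delta i : exists p, f p = delta_mx 0 i.
  have [l xl] := rV0Pn _ (nx i).
  have sep j : exists F : mpolyQ n, [/\ F \is 1.-homog,
      (j != i -> F.@[x j 0] = 0) & F.@[x i 0] != 0].
    have [->|ji] := eqVneq j i.
      by exists 'X_l; rewrite mevalXU; split=> //; exact: dhomogU.
    have ij : i != j by rewrite eq_sym.
    have [F [h1 h2 h3]] := line_separation (nx i) (nx j) (dx _ _ ij).
    by exists F.
  pose F j := sval (cid (sep j)).
  have FP j : [/\ F j \is 1.-homog, (j != i -> (F j).@[x j 0] = 0) &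
    (F j).@[x i 0] != 0] := svalP (cid (sep j)).
  pose G := (\prod_(j < k) F j) * 'X_l ^+ (t - k).
  have hG : G \is t.-homog.
    rewrite -(subnKC kt); apply: dhomogM.
      have := @dhomog_prod1 _ _ (enum 'I_k) F.
      by rewrite size_enum_ord big_enum; apply=> j; case: (FP j).
    by have := dhomogMn (t - k) (dhomogU l); rewrite mul1n.
  have Gi : G.@[x i 0] != 0.
    rewrite mevalM rmorphXn /= mevalXU mulf_neq0 ?expf_neq0 //.
    by rewrite rmorph_prod /=; apply/prodf_neq0 => j _; case: (FP j).
  have Gj j : j != i -> G.@[x j 0] = 0.
    move=> ji; rewrite mevalM rmorph_prod /= (bigD1 j) //=.
    by case: (FP j) => _ -> //; rewrite !mul0r.
  exists (G.@[x i 0]^-1 *: DHomog hG).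
  rewrite linearZ /= fE; apply/rowP => j; rewrite !mxE /=.
  have [->|ji] := eqVneq j i; first by rewrite mulVf.
  by rewrite (Gj j ji) mulr0.
have full : (fullv <= limg f)%VS.
  apply/subvP => v _; rewrite (row_sum_delta v); apply: memv_suml => i _.
  by have [p <-] := delta i; rewrite memvZ // memv_img // memvf.
have := limg_ker_dim f fullv; rewrite capfv; move: (dimvS full) (dimvS ker).
rewrite [\dim {: 'rV_k}]dimvf /dim /= mul1n.
move=> kL Jker dimf; have := hfK J t; rewrite -[\dim fullv]dimf => e.
rewrite -(leq_add2r (\dim (degpart J t))) e addnC.
exact: leq_add.
Qed.

Lemma poly_eq0_nat (p : {poly rat}) t0 :
  (forall t : nat, (t0 <= t)%N -> p.[t%:R] = 0) -> p = 0.
Proof.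
move=> h; apply: (@roots_geq_poly_eq0 _ p [seq t%:R | t <- iota t0 (size p)]).
- apply/allP => x /mapP[t]; rewrite mem_iota => /andP[le _] ->.
  by apply/rootP; apply: h.
- rewrite map_inj_uniq ?iota_uniq // => a b /eqP.
  by rewrite eqr_nat => /eqP.
by rewrite size_map size_iota.
Qed.

(** An increment that takes finitely many values takes one of them infinitely
    often, so the polynomial of increments is constant. *)
Lemma affine_of_bounded_increments (H : {poly rat}) (t0 M : nat) (g : nat -> nat) :
  (forall t, (t0 <= t)%N -> H.[t.+1%:R] - H.[t%:R] = (g t)%:R) ->
  (forall t, (t0 <= t)%N -> (g t <= M)%N) ->
  exists v : nat, exists c, H = v%:R *: 'X + c%:P /\
    forall t, (t0 <= t)%N -> g t = v.
Proof.
move=> Hg gM.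
pose G := H \Po ('X + 1%:P) - H.
have GE (t : nat) : G.[t%:R] = H.[t.+1%:R] - H.[t%:R].
  by rewrite hornerD hornerN horner_comp !hornerE -natr1.
have [v Gv] : exists v : nat, G = v%:R%:P.
  apply: contrapT => /forallNP nv.
  have : \prod_(v < M.+1) (G - (v : nat)%:R%:P) != 0.
    by apply/prodf_neq0 => v _; rewrite subr_eq0; apply/eqP/nv.
  move/eqP; apply; apply: (@poly_eq0_nat _ t0) => t tt.
  have lt : (g t < M.+1)%N by rewrite ltnS gM.
  rewrite horner_prod (bigD1 (Ordinal lt)) //= hornerD hornerN hornerC GE.
  by rewrite Hg // subrr mul0r.
have gv t : (t0 <= t)%N -> g t = v.
  by move=> tt; apply/eqP; rewrite -(eqr_nat rat) -Hg // -GE Gv hornerC.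
pose c := H.[t0%:R] - v%:R * t0%:R; exists v; exists c; split=> //.
apply/eqP; rewrite -subr_eq0; apply/eqP/(@poly_eq0_nat _ t0) => t tt.
rewrite hornerD hornerN hornerD hornerZ hornerX hornerC -(subnKC tt).
elim: (t - t0)%N => [|s IH]; first by rewrite addn0 /c; ring.
have := Hg (t0 + s)%N (leq_addr _ _); rewrite gv ?leq_addr // => e.
have -> : H.[(t0 + s.+1)%:R] = H.[(t0 + s)%:R] + v%:R by rewrite addnS -e; ring.
rewrite -[RHS]IH addnS -[(t0 + s).+1%:R]natr1; ring.
Qed.

Section Degree.
Variables (n : nat) (P : {pred mpolyQ n}) (e : nat).
Hypotheses (pP : proj_prime P) (dimP : ~ irreducible_chain P 2)
  (degP : irreducible_degree P e).

Let hP : hideal P. Proof. by case: pP => /homog_idealW. Qed.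

(** As V(P) has dimension at most one, the increments of the Hilbert function
    of [P], which are the values of that of [P + F], are bounded.  So the
    Hilbert polynomial is either [e * t + c], and [e] is the value of the
    increments, or the constant [e]. *)
Lemma hf_curve F : F \is 1.-homog -> F \notin P ->
  (0 < e)%N /\ exists t0, forall t, (t0 <= t)%N ->
    hf (add_ideal P F) t = e \/ hf P t = e.
Proof.
move=> hF FP.
have [|M bM] := @hf_boundedP n (add_ideal P F).
  by move/(chain_of_unbounded pP hF FP).
have [H [t0 HP] eH] := degP.
have HE (t : nat) : (t0 <= t)%N -> H.[t%:R] = (hf P t)%:R.
  by move=> /HP[h /(hilbert_functionE hP) <-].
have [|t _|v [c [Hvc gv]]] := @affine_of_bounded_increments H t0 M
  (fun t => hf (add_ideal P F) t.+1).
- move=> t tt; rewrite !HE ?(leq_trans tt) // (hf_hyperplane _ pP hF FP).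
  by rewrite natrD addrK.
- exact: bM.
have [v0|v0] := posnP v.
  have HC : H = c%:P by rewrite Hvc v0 scale0r add0r.
  have ec : e%:R = c.
    rewrite eH HC lead_coefC size_polyC.
    by case: (c != 0); rewrite /= fact0 mul1r.
  have hc t : (t0 <= t)%N -> hf P t = e.
    by move=> tt; apply/eqP; rewrite -(eqr_nat rat) -HE // HC hornerC ec.
  split; first by rewrite -(hc t0) // hf_prime_gt0.
  by exists t0 => t tt; right; apply: hc.
have ev : e = v.
  have v0R : v%:R != 0 :> rat by rewrite pnatr_eq0 -lt0n.
  have sX : size (v%:R *: 'X : {poly rat}) = 2 by rewrite size_scale // size_polyX.
  have sc : (size (c%:P) < size (v%:R *: 'X : {poly rat}))%N.
    by rewrite sX size_polyC; case: (c != 0).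
  apply/eqP; rewrite -(eqr_nat rat) eH Hvc size_polyDl // sX /= lead_coefDl //.
  by rewrite lead_coefZ lead_coefX mulr1 factS fact0 mul1r.
split; first by rewrite ev.
exists t0.+1 => -[//|t] tt; left; rewrite ev; exact: gv.
Qed.

Lemma irreducible_degree_gt0 : (0 < e)%N.
Proof. by case: pP => _ _ [i Xi]; case: (hf_curve (dhomogU i) Xi). Qed.

(** Bezout for hyperplane sections: the points lie in the zeros of [P + F] and of
    [P], one of which has Hilbert function [e] in large degrees. *)
Lemma hyperplane_section F k (x : 'I_k -> 'rV[rat]_n.+1) :
  F \is 1.-homog -> F \notin P -> (forall i, x i != 0) ->
  (forall i j, i != j -> <[x i]>%VS != <[x j]>%VS) ->
  (forall i, in_zeros P (x i)) -> (forall i, F.@[x i 0] = 0) -> (k <= e)%N.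
Proof.
move=> hF FP nx dx zx Fx; have [_ [t0 h]] := hf_curve hF FP.
have [<-|<-] := h _ (leq_addr k t0); apply: (points_le_hf (x := x));
  rewrite ?leq_addl //.
  exact: hideal_add hF.
move=> i p /add_idealP[q /(zx i)]; by rewrite mevalB mevalM Fx mulr0 subr0.
Qed.

End Degree.

Local Open Scope classical_set_scope.

(** * Irreducible components and their linear spans *)

(** The homogeneous prime ideal of the point of projective space given by [x]. *)
Definition point_ideal n (x : 'rV[rat]_n.+1) : {pred mpolyQ n} :=
  [pred p | `[< forall k, (pihomog mdeg k p).@[x 0] = 0 >]].

Lemma point_idealP n (x : 'rV[rat]_n.+1) p :
  reflect (forall k, (pihomog mdeg k p).@[x 0] = 0) (p \in point_ideal x).
Proof. exact: asboolP. Qed.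

Lemma point_ideal_zero n (x : 'rV[rat]_n.+1) : in_zeros (point_ideal x) x.
Proof.
move=> p /point_idealP h; rewrite (pihomog_partitionE (leqnn (msize p))).
by rewrite raddf_sum big1 //= => i _; exact: h.
Qed.

Lemma point_ideal_hideal n (x : 'rV[rat]_n.+1) : hideal (point_ideal x).
Proof.
split; first split.
- by apply/point_idealP => k; rewrite raddf0 meval0.
- move=> a u v /point_idealP hu /point_idealP hv; apply/point_idealP => k.
  rewrite raddfD mevalD hv addr0 (pihomog_partitionE (leqnn (msize u))).
  rewrite mulr_sumr (raddf_sum (pihomog mdeg k)) (raddf_sum (meval (x 0))).
  rewrite big1 //= => i _.
  have hi := pihomogP mdeg i u.
  have [ki|ik] := ltnP k i; first by rewrite (pihomogM_lt _ hi) // meval0.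
  by rewrite -{1}(subnK ik) (pihomogM _ _ hi) mevalM hu mulr0.
move=> p /point_idealP hp k; apply/point_idealP => l.
have [->|kl] := eqVneq l k; first by rewrite pihomog_id.
by rewrite (@pihomog_ne0 _ _ mdeg k) ?meval0 // 1?eq_sym // pihomogP.
Qed.

Lemma point_ideal_homog n (x : 'rV[rat]_n.+1) p k : p \is k.-homog ->
  (p \in point_ideal x) = (p.@[x 0] == 0).
Proof.
move=> hp; apply/point_idealP/eqP => [/(_ k)|px l]; first by rewrite pihomog_dE.
have [->|kl] := eqVneq l k; first by rewrite pihomog_dE.
by rewrite (@pihomog_ne0 _ _ mdeg k) ?meval0 // eq_sym.
Qed.

Lemma point_ideal_prime n (x : 'rV[rat]_n.+1) : x != 0 ->
  proj_prime (point_ideal x).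
Proof.
move=> nx; have hx := point_ideal_hideal x; split.
- case: hx => -[h0 h] hc; split=> //; split=> //.
  by rewrite (point_ideal_homog _ (dhomog1 rat mdeg)) meval1 oner_eq0.
- apply: prime_homogP => // a b k l ha hb.
  rewrite (point_ideal_homog _ (dhomogM ha hb)) (point_ideal_homog _ ha).
  by rewrite (point_ideal_homog _ hb) mevalM mulf_eq0.
have [i xi] := rV0Pn _ nx; exists i.
by rewrite (point_ideal_homog _ (dhomogU i)) mevalXU.
Qed.

(** Zorn's lemma applied to the complements of the primes between [I] and [Q0];
    the union of a chain of complements is the complement of a prime. *)
Lemma minimal_prime_below n (I Q0 : {pred mpolyQ n}) : proj_prime Q0 ->
  {subset I <= Q0} ->
  exists2 P, irreducible_component I P & {subset P <= Q0}.
Proof.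
move=> pQ0 IQ0.
pose co (A : set (mpolyQ n)) : {pred mpolyQ n} := [pred p | `[< ~ A p >]].
have coP A p : reflect (~ A p) (p \in co A) by exact: asboolP.
pose ok A := [/\ proj_prime (co A), {subset I <= co A} & {subset co A <= Q0}].
have [F Fok totF|A [A0 maxA]] := @Zorn_bigcup _ (fun A => A = set0 \/ ok A).
  (* The empty set is admitted for the sake of the empty chain. *)
  have [F0|] := pselect (forall A, F A -> A = set0).
    by left; rewrite -subset0 => p [A FA]; rewrite (F0 A FA).
  move=> /existsNP[A0 /not_implyP[FA0 nA0]]; right.
  have okF A : F A -> A <> set0 -> ok A by move=> /Fok[].
  have inU p : p \in co (\bigcup_(X in F) X) <-> forall A, F A -> p \in co A.
    split=> [/coP h A FA|h]; first by apply/coP => Ap; apply: h; exists A.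
    by apply/coP => -[A FA Ap]; have /coP := h A FA.
  have co0 p : p \in co set0 by apply/coP.
  have [[[[h0 h1 h2] hc] pr [i Xi]] _ AQ] := okF A0 FA0 nA0.
  split; last by move=> p /inU /(_ _ FA0)/AQ.
  - split.
    + split; first split.
      * apply/inU => A FA; have [->//|/(okF _ FA)] := pselect (A = set0).
        by case=> -[[[]]].
      * by apply: contra h1 => /inU /(_ _ FA0).
      * move=> a u v /inU uF /inU vF; apply/inU => A FA.
        have [->//|/(okF _ FA)] := pselect (A = set0).
        by case=> -[[[_ _ h] _] _ _] _ _; apply: h; [exact: uF|exact: vF].
      move=> p /inU pF k; apply/inU => A FA.
      have [->//|/(okF _ FA)] := pselect (A = set0).
      by case=> -[[_ h] _ _] _ _; apply: h; exact: pF.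
    + move=> u v /inU uvF; apply: contrapT => /negP; rewrite negb_or.
      have nco p : p \notin co (\bigcup_(X in F) X) -> exists2 A, F A & A p.
        move=> /negP np; apply: contrapT => h; apply: np; apply/coP => -[A FA Ap].
        by apply: h; exists A.
      move=> /andP[/nco[A FA Au] /nco[B FB Bv]].
      have [C [FC Cu Cv]] : exists C, [/\ F C, C u & C v].
        by have [AB|BA] := totF A B FA FB; [exists B|exists A]; split=> //;
          [apply: AB|apply: BA].
      have C0 : C <> set0 by move=> C0; move: Cu; rewrite C0.
      have [[_ prC _] _ _] := okF C FC C0.
      by have /prC/orP[/coP|/coP] := uvF C FC; apply.
    by exists i; apply: contra Xi => /inU /(_ _ FA0).
  move=> p pI; apply/inU => A FA.
  have [->//|/(okF _ FA)] := pselect (A = set0).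
  by case=> _ h _; apply: h.
have okQ0 : ok (~` [set` Q0]).
  have e : co (~` [set` Q0]) =i Q0.
    by move=> p; apply/coP/idP => [|pQ h]; [rewrite notK|apply: h].
  rewrite /ok; have -> : co (~` [set` Q0]) = Q0.
    by apply/funext => p; have := e p; rewrite /in_mem /=.
  by split.
have okA : ok A.
  case: A0 => // A0; case: (maxA (~` [set` Q0])); last by right.
  rewrite A0; split; first exact: sub0set.
  move=> /(_ 1); apply; rewrite /=.
  by have [[[_ /negP]]] := pQ0.
have [pA IA AQ] := okA.
exists (co A) => //; split=> // Q pQ IQ QA p pA'.
apply: contrapT => pQ'; apply: (maxA (~` [set` Q])).
  split.
    by move=> q Aq /= qQ; have /coP := QA _ qQ.
  by move/(_ p pQ'); have /coP := pA'.
right; rewrite /ok.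
have -> : co (~` [set` Q]) = Q.
  apply/funext => q; apply/idP/idP.
    by move=> /asboolP; rewrite notK.
  by move=> qQ; apply/asboolP; apply.
by split=> // q /QA/AQ.
Qed.

Lemma point_component n (I : {pred mpolyQ n}) (x : 'rV[rat]_n.+1) :
  homog_ideal I -> x != 0 -> in_zeros I x ->
  exists2 P, irreducible_component I P & in_zeros P x.
Proof.
move=> /homog_idealW hI nx zx.
have [|P cP PQ] := minimal_prime_below (I := I) (point_ideal_prime nx).
  by move=> p pI; apply/point_idealP => k; apply: zx; apply: hideal_pihomog.
by exists P => // p /PQ/point_ideal_zero.
Qed.

Definition linear_form n (phi : {scalar 'rV[rat]_n.+1}) : mpolyQ n :=
  \sum_i phi (delta_mx 0 i) *: 'X_i.

Lemma linear_form_homog n (phi : {scalar 'rV[rat]_n.+1}) :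
  linear_form phi \is 1.-homog.
Proof. by apply: rpred_sum => i _; rewrite rpredZ // dhomogU. Qed.

Lemma linear_formE n (phi : {scalar 'rV[rat]_n.+1}) (x : 'rV[rat]_n.+1) :
  (linear_form phi).@[x 0] = phi x.
Proof.
rewrite /linear_form raddf_sum /= {2}(row_sum_delta x) raddf_sum /=.
by apply: eq_bigr => i _; rewrite mevalZ mevalXU linearZ mulrC.
Qed.

(** With the linear span of V(P) defined by the linear forms in [P], a linear
    form that does not vanish on the span is not in [P]. *)
Lemma linear_span n (P : {pred mpolyQ n}) :
  exists V : {vspace 'rV[rat]_n.+1}, forall x,
    x \in V <-> forall phi, linear_form phi \in P -> phi x = 0.
Proof.
have [| |V VP] := @vspace_of_closed _ 'rV[rat]_n.+1
    [pred x | `[< forall phi : {scalar 'rV[rat]_n.+1},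
       linear_form phi \in P -> phi x = 0 >]].
- by apply/asboolP => phi _; rewrite raddf0.
- move=> a u v /asboolP hu /asboolP hv; apply/asboolP => phi hphi.
  by rewrite linearP hu // hv // mulr0 addr0.
by exists V => x; rewrite VP; split=> [/asboolP|h] //; apply/asboolP.
Qed.

Lemma few_hyperplane_points (R : numDomainType) n (P : {pred mpolyQ n}) e
    (phi : {scalar 'rV[rat]_n.+1}) :
  proj_prime P -> ~ irreducible_chain P 2 -> irreducible_degree P e ->
  linear_form phi \notin P ->
  few_lines (fun x => in_zeros P x /\ phi x = 0) (e%:R : R).
Proof.
move=> pP dP eP phiP s us hs; rewrite ler_nat.
have h (i : 'I_(size s)) : exists x : 'rV[rat]_n.+1,
    [/\ x != 0, in_zeros P x /\ phi x = 0 & tnth (in_tuple s) i = <[x]>%VS].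
  by apply: hs; exact: mem_tnth.
pose x i := sval (cid (h i)).
have xP i : [/\ x i != 0, in_zeros P (x i) /\ phi (x i) = 0 &
  tnth (in_tuple s) i = <[x i]>%VS] := svalP (cid (h i)).
apply: (hyperplane_section pP dP eP (linear_form_homog phi) phiP (x := x)).
- by move=> i; case: (xP i).
- move=> i j ij; have [_ _ <-] := xP i; have [_ _ <-] := xP j.
  by apply: contra ij => /eqP/(elimT (tuple_uniqP (in_tuple s)) us) ->.
- by move=> i; case: (xP i) => _ [].
- by move=> i; rewrite linear_formE; case: (xP i) => _ [].
Qed.

(** All that the counting argument uses about a curve.  [V i] is the linear span
    of the component [Z i]. *)
Lemma curve_components (R : numDomainType) n (C : {pred mpolyQ n}) d :
  proj_curve C -> curve_degree C d ->
  exists k (e : 'I_k -> nat) (Z : 'I_k -> 'rV[rat]_n.+1 -> Prop)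
    (V : 'I_k -> {vspace 'rV[rat]_n.+1}),
  [/\ d = (\sum_(i < k) e i)%N, forall i, (0 < e i)%N,
      forall x, x != 0 -> in_zeros C x -> exists i, Z i x,
      forall i x, Z i x -> x \in V i &
      forall i (phi : {scalar 'rV[rat]_n.+1}) v, v \in V i -> phi v != 0 ->
        few_lines (fun x => Z i x /\ phi x = 0) ((e i)%:R : R)].
Proof.
move=> [[homC _] dimC] [k [P [e [compP _ degP ->]]]].
have comp i : irreducible_component C (P i) by apply/compP; exists i.
have pP i : proj_prime (P i) by case: (comp i).
have dP i : ~ irreducible_chain (P i) 2 by case: (dimC _ (comp i)).
pose V i := sval (cid (linear_span (P i))).
have VP i x : x \in V i <-> forall phi, linear_form phi \in P i -> phi x = 0.
  exact: (svalP (cid (linear_span (P i)))).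
exists k, e, (fun i => in_zeros (P i)), V; split=> //.
- by move=> i; apply: irreducible_degree_gt0 (pP i) (dP i) (degP i).
- move=> x nx zx; have [Q cQ zQ] := point_component homC nx zx.
  have /compP[i QP] := cQ; exists i => p pPi; apply: zQ.
  by rewrite QP.
- by move=> i x zx; apply/VP => phi /zx; rewrite linear_formE.
move=> i phi v /VP vV phiv; apply: few_hyperplane_points => //.
by apply: contra phiv => /vV ->.
Qed.

End CurveAlgebra.

(** * Successive minima *)

(** Simultaneous approximation, by sorting the multiples of [t] into the [Q ^ r]
    cells of the unit cube. *)
Lemma dirichlet r Q (t : nat -> rat) : (0 < Q)%N ->
  exists k : nat, [/\ (0 < k)%N, (k <= Q ^ r)%N &
    exists m : nat -> int, forall j, (j < r)%N ->
      `|k%:R * t j - (m j)%:~R| * Q%:R < 1].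
Proof.
move=> Q0.
pose fr (x : rat) := x - (Num.floor x)%:~R.
have fr0 x : 0 <= fr x by rewrite subr_ge0 floor_le.
have fr1 x : fr x < 1 by have := floorD1_gt x; rewrite /fr intrD; lra.
have cell (x : rat) : (Num.truncn (Q%:R * fr x) < Q)%N.
  by rewrite truncn_lt_nat ?mulr_ge0 // -[ltRHS]mulr1 ltr_pM2l ?ltr0n.
pose f (k : 'I_(Q ^ r).+1) : {ffun 'I_r -> 'I_Q} :=
  [ffun j : 'I_r => Ordinal (cell ((val k)%:R * t j))].
have [k1 [k2 [k12 fk]]] : exists k1 k2 : 'I_(Q ^ r).+1, (k1 < k2)%N /\ f k1 = f k2.
  have : ~ injective f.
    by move/leq_card; rewrite card_ffun !card_ord ltnn.
  move=> ninj; apply: contrapT => no; apply: ninj => k1 k2 fk.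
  apply: val_inj; apply/eqP; apply: contraT; rewrite neq_ltn => /orP[lt|lt].
    by case: no; exists k1, k2.
  by case: no; exists k2, k1.
exists (k2 - k1)%N; split; first by rewrite subn_gt0.
  by rewrite leq_subLR (leq_trans _ (leq_addl _ _)) // -ltnS ltn_ord.
exists (fun j => Num.floor ((val k2)%:R * t j) - Num.floor ((val k1)%:R * t j)).
move=> j jr; have /ffunP/(_ (Ordinal jr)) := fk; rewrite !ffunE => -[e].
have -> : (k2 - k1)%:R * t j -
    (Num.floor ((val k2)%:R * t j) - Num.floor ((val k1)%:R * t j))%:~R =
    fr ((val k2)%:R * t j) - fr ((val k1)%:R * t j).
  by rewrite natrB 1?ltnW // rmorphB /= /fr; ring.
have b (x : rat) : (Num.truncn (Q%:R * fr x))%:R <= Q%:R * fr x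
    < (Num.truncn (Q%:R * fr x))%:R + 1.
  by have := truncn_itv (mulr_ge0 (ler0n _ Q) (fr0 x)); rewrite -natr1.
move: (b (k2%:R * t j)) (b (k1%:R * t j)); rewrite e.
set x := fr _; set y := fr _ => /andP[a1 a2] /andP[a3 a4].
have Qp : 0 < Q%:R :> rat by rewrite ltr0n.
rewrite -[Q%:R]gtr0_norm // -normrM mulrC mulrBr ltr_norml; lra.
Qed.

Section Height.
Variable N : nat.
Implicit Types (x y z : 'rV[int]_N).

Definition hgt x : nat := \max_i absz (x 0%R i).

Definition toQ x : 'rV[rat]_N := map_mx intr x.

Lemma toQ_is_additive : zmod_morphism toQ.
Proof. by move=> x y; rewrite /toQ map_mxB. Qed.

HB.instance Definition _ := GRing.isZmodMorphism.Build _ _ toQ toQ_is_additive.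

Lemma toQE x i : toQ x 0 i = (x 0 i)%:~R. Proof. by rewrite mxE. Qed.

Lemma toQZ (a : int) x : toQ (a *: x) = a%:~R *: toQ x.
Proof. by apply/rowP => i; rewrite !mxE rmorphM. Qed.

Lemma toQ_inj : injective toQ.
Proof. by move=> x y /rowP e; apply/rowP => i; have := e i; rewrite !mxE => /intr_inj. Qed.

Lemma toQ_eq0 x : (toQ x == 0) = (x == 0).
Proof. by rewrite -(inj_eq toQ_inj) raddf0. Qed.

Lemma hgtP x m : reflect (forall i, absz (x 0%R i) <= m)%N (hgt x <= m)%N.
Proof.
apply: (iffP (bigmax_leqP _ _ _)) => [h i|h i _]; [exact: h|exact: h].
Qed.

Lemma coord_le_hgt x i : `|toQ x 0 i| <= (hgt x)%:R.
Proof.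
by rewrite toQE -intr_norm -abszE ler_nat; apply: (elimT (hgtP x _) (leqnn _)).
Qed.

Lemma hgt_le_coord x (M : rat) : 0 <= M -> (forall i, `|toQ x 0 i| <= M) ->
  (hgt x)%:R <= M.
Proof.
move=> M0 h; rewrite -truncn_ge_nat //; apply/hgtP => i.
by rewrite truncn_ge_nat // natr_absz intr_norm -toQE.
Qed.

Lemma hgt_eq0 x : (hgt x == 0%N) = (x == 0).
Proof.
rewrite -leqn0; apply/hgtP/eqP => [h|-> i]; last by rewrite mxE.
by apply/rowP => i; rewrite mxE; apply/eqP; rewrite -absz_eq0 -leqn0.
Qed.

Lemma clear_denominators (y : 'rV[rat]_N) :
  exists2 D : nat, (0 < D)%N & exists z, toQ z = D%:R *: y.
Proof.
pose D := (\prod_i absz (denq (y 0%R i)))%N.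
have D0 : (0 < D)%N by apply: prodn_gt0 => i; rewrite absz_gt0 denq_neq0.
exists D => //; exists (\row_i (numq (y 0 i) * (D %/ absz (denq (y 0%R i)))%N%:Z)).
apply/rowP => i; rewrite toQE !mxE rmorphM /= numqE -mulrA mulrC; congr (_ * _).
rewrite -[(denq _)]gez0_abs // ?denq_ge0 // -rmorphM /= -PoszM mulnC divnK //.
by rewrite /D (bigD1 i) //= dvdn_mulr.
Qed.

(** [greedy V r v] says that [v 0], ..., [v r.-1] are successive minima of the
    lattice of integral vectors of [V]. *)
Definition prev_span (v : nat -> 'rV[int]_N) j : {vspace 'rV[rat]_N} :=
  <<mkseq (fun i => toQ (v i)) j>>%VS.

Definition greedy (V : {vspace 'rV[rat]_N}) r (v : nat -> 'rV[int]_N) :=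
  forall j, (j < r)%N -> [/\ toQ (v j) \in V, toQ (v j) \notin prev_span v j &
    forall z, toQ z \in V -> toQ z \notin prev_span v j -> (hgt (v j) <= hgt z)%N].

Lemma prev_spanS v j : prev_span v j.+1 = (prev_span v j + <[toQ (v j)]>)%VS.
Proof. by rewrite /prev_span mkseqS -cats1 span_cat span_seq1. Qed.

Lemma eq_prev_span v w j : (forall i, (i < j)%N -> v i = w i) ->
  prev_span v j = prev_span w j.
Proof.
move=> e; congr <<_>>%VS; apply/eq_in_map => i.
by rewrite mem_iota => /e ->.
Qed.

Lemma prev_span_mono v i j : (i <= j)%N -> (prev_span v i <= prev_span v j)%VS.
Proof.
move/subnK<-; elim: (j - i)%N => [|k IH]; first exact: subvv.
by rewrite addSn prev_spanS (subv_trans IH) // addvSl.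
Qed.

Lemma mem_prev_span v i j : (i < j)%N -> toQ (v i) \in prev_span v j.
Proof.
move=> ij; apply: (subvP (prev_span_mono v ij)); rewrite prev_spanS.
by apply: (subvP (addvSr _ _)); exact: memv_line.
Qed.

Lemma sum_prev_span (v : nat -> 'rV[int]_N) (c : nat -> rat) j :
  \sum_(i < j) c i *: toQ (v i) \in prev_span v j.
Proof. by apply: memv_suml => i _; rewrite memvZ // mem_prev_span. Qed.

Lemma prev_spanP (v : nat -> 'rV[int]_N) j (y : 'rV[rat]_N) :
  y \in prev_span v j ->
  exists c : nat -> rat, y = \sum_(i < j) c i *: toQ (v i).
Proof.
elim: j y => [|j IH] y.
  by rewrite /prev_span span_nil memv0 => /eqP->; exists (fun=> 0); rewrite big_ord0.
rewrite prev_spanS => /memv_addP[u /IH[c ->] [w /vlineP[a ->] ->]].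
exists (fun i => if (i < j)%N then c i else a).
rewrite big_ord_recr /= ltnn; congr (_ + _).
by apply: eq_bigr => i _; rewrite ltn_ord.
Qed.

Lemma dim_prev_span v j : (\dim (prev_span v j) <= j)%N.
Proof. by apply: leq_trans (dim_span _) _; rewrite size_mkseq. Qed.

Lemma greedy_exists V r : (r <= \dim V)%N -> exists v, greedy V r v.
Proof.
elim: r => [|r IH] rV; first by exists (fun=> 0).
have [v gv] := IH (ltnW rV).
have ex : exists h, `[< exists z, [/\ toQ z \in V, toQ z \notin prev_span v r &
    hgt z = h] >].
  have [y yV yW] : exists2 y, y \in V & y \notin prev_span v r.
    apply: contrapT => /forall2NP h.
    have /dimvS : (V <= prev_span v r)%VS.
      apply/subvP => y yV; case: (h y) => // /negP; by rewrite negbK.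
    by rewrite leqNgt => /negP; apply; apply: leq_ltn_trans (dim_prev_span v r) rV.
  have [D D0 [z zE]] := clear_denominators y.
  exists (hgt z); apply/asboolP; exists z; rewrite zE; split=> //.
    exact: memvZ.
  apply: contra yW => /(memvZ D%:R^-1).
  by rewrite scalerA mulVf ?scale1r // pnatr_eq0 -lt0n.
case: (ex_minnP ex) => h /asboolP[z [zV zW <-]] zmin.
exists (fun i => if (i < r)%N then v i else z).
have eW j : (j <= r)%N ->
    prev_span (fun i => if (i < r)%N then v i else z) j = prev_span v j.
  by move=> jr; apply: eq_prev_span => i ij; rewrite (leq_trans ij jr).
move=> j; rewrite ltnS leq_eqVlt => /orP[/eqP->|jr]; rewrite eW ?ltnn //.
  split=> // y yV yW; apply: zmin; apply/asboolP; by exists y.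
  by rewrite jr; apply: gv.
by rewrite ltnW.
Qed.

End Height.

Section Reduced.
Variable N : nat.
Implicit Types (V : {vspace 'rV[rat]_N}) (v : nat -> 'rV[int]_N) (z : 'rV[int]_N).

Lemma greedyW V r s v : (s <= r)%N -> greedy V r v -> greedy V s v.
Proof. by move=> sr gv j js; apply: gv; apply: leq_trans js sr. Qed.

Lemma greedy_hgt_mono V r v i j : greedy V r v -> (i <= j)%N -> (j < r)%N ->
  (hgt (v i) <= hgt (v j))%N.
Proof.
move=> gv ij jr; have [jV jW _] := gv j jr.
have [_ _ min] := gv i (leq_ltn_trans ij jr).
apply: min => //; apply: contra jW; exact: (subvP (prev_span_mono v ij)).
Qed.

Lemma greedy_hgt_gt0 V r v j : greedy V r v -> (j < r)%N -> (0 < hgt (v j))%N.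
Proof.
move=> gv jr; have [_ jW _] := gv j jr.
by rewrite lt0n hgt_eq0 -toQ_eq0; apply: contraNneq jW => ->; rewrite mem0v.
Qed.

Lemma dim_greedy V r v : greedy V r v -> \dim (prev_span v r) = r.
Proof.
elim: r => [|r IH] gv.
  by rewrite /prev_span span_nil dimv0.
have [_ rW _] := gv r (ltnSn r).
have W1 := prev_spanS v r.
rewrite W1 dimv_disjoint_sum.
  rewrite IH; last exact: greedyW gv.
  rewrite dim_vline; case: eqP rW => [->|_ _]; first by rewrite mem0v.
  by rewrite addn1.
apply/eqP; rewrite -subv0; apply/subvP => y /memv_capP[yW /vlineP[a ya]].
rewrite memv0 ya scaler_eq0; apply: contraT; rewrite negb_or => /andP[a0 _].
case/negP: rW; have := memvZ a^-1 yW; by rewrite ya scalerA mulVf // scale1r.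
Qed.

Lemma greedy_span V v : greedy V (\dim V) v -> prev_span v (\dim V) = V.
Proof.
move=> gv; apply/eqP; rewrite eqEdim (dim_greedy gv) leqnn andbT.
apply/span_subvP => y /mapP[i]; rewrite mem_iota => ir ->.
by have [] := gv i ir.
Qed.

(** Successive minima are reduced.  For the last coefficient [c r], Dirichlet
    gives [k] and an integral vector z = k * v r - (earlier vectors) which is
    [k / c r] times the given sum plus a vector of height at most
    [hgt (v r) / 2].  As z is outside the earlier span its height is at least
    [hgt (v r)], so the given sum has height at least |c r| hgt (v r) / (2 k).
    Then remove the last term and induct. *)
Lemma greedy_coef r : exists K : nat, forall V v, greedy V r v ->
  forall (c : nat -> rat) M, (forall i, `|(\sum_(j < r) c j *: toQ (v j)) 0 i| <= M) ->
  forall j, (j < r)%N -> `|c j| * (hgt (v j))%:R <= K%:R * M.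
Proof.
elim: r => [|r [K IH]]; first by exists 0%N.
pose Q := (2 * r.+1)%N; pose T := (2 * Q ^ r)%N.
exists (T + K * T.+1)%N => V v gv c M hM.
have [rV rW rmin] := gv r (ltnSn r).
have gvr := greedyW (leqnSn r) gv.
have [N0|N0] := posnP N.
  by have := greedy_hgt_gt0 gv (ltnSn r); rewrite lt0n hgt_eq0; case/eqP;
     apply/rowP => i; exfalso; move: i; rewrite N0 => -[].
have M0 : 0 <= M by apply: le_trans (hM (Ordinal N0)).
have top : `|c r| * (hgt (v r))%:R <= T%:R * M.
  have [->|cr] := eqVneq (c r) 0; first by rewrite normr0 mul0r mulr_ge0.
  (* With [Q = 2 * r.+1] the [r] error terms add up to at most half of [hgt (v r)]. *)
  have [k [k0 kQ [m hm]]] := @dirichlet r Q (fun j => - (c j / c r)) isT.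
  pose z := v r *+ k - \sum_(j < r) m j *: v j.
  have zE : toQ z = (k%:R / c r) *: (\sum_(j < r.+1) c j *: toQ (v j)) +
      \sum_(j < r) (k%:R * - (c j / c r) - (m j)%:~R) *: toQ (v j).
    rewrite /z raddfB raddf_sum raddfMn /= big_ord_recr /= scalerDr scalerA.
    rewrite divfK // scaler_nat addrAC addrC scaler_sumr -big_split /=.
    congr (_ + _); rewrite -sumrN; apply: eq_bigr => j _.
    rewrite toQZ scalerA -scalerDl -scaleNr; congr (_ *: _); ring.
  have zW : toQ z \notin prev_span v r.
    rewrite /z raddfB raddf_sum raddfMn /=; apply: contra rW => h.
    have : toQ (v r) *+ k \in prev_span v r.
      rewrite -(subrK (\sum_(j < r) toQ (m j *: v j)) (_ *+ k)) memvD //.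
      apply: memv_suml => j _; rewrite toQZ memvZ //; exact: mem_prev_span.
    rewrite -scaler_nat => /(memvZ k%:R^-1); rewrite scalerA mulVf ?scale1r //.
    by rewrite pnatr_eq0 -lt0n.
  have zV : toQ z \in V.
    rewrite /z raddfB raddf_sum raddfMn /=; apply: rpredB; first exact: rpredMn.
    apply: memv_suml => j _; rewrite toQZ memvZ //.
    by case: (gvr j (ltn_ord j)).
  have cr0 : 0 < `|c r| by rewrite normr_gt0.
  have hz : (hgt z)%:R <= k%:R * M / `|c r| + (hgt (v r))%:R / 2.
    apply: hgt_le_coord => [|i].
      by rewrite addr_ge0 // ?divr_ge0 // mulr_ge0.
    rewrite zE mxE; apply: le_trans (ler_normD _ _) _; apply: lerD.
      rewrite mxE normrM normrM normfV (ger0_norm (ler0n _ k)) // mulrAC.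
      by rewrite ler_pM2r ?invr_gt0 // ler_wpM2l.
    rewrite summxE; apply: le_trans (ler_norm_sum _ _ _) _.
    apply: le_trans (_ : \sum_(j < r) (hgt (v r))%:R / Q%:R <= _).
      apply: ler_sum => j _; rewrite mxE normrM mulrC.
      apply: ler_pM => //; last first.
        rewrite -[leRHS]mul1r ler_pdivlMr ?ltr0n //.
        by apply: ltW; apply: hm.
      apply: le_trans (coord_le_hgt _ _) _.
      by rewrite ler_nat (greedy_hgt_mono gv) // ltnW.
    rewrite sumr_const card_ord -[leLHS]mulr_natr -mulrA ler_wpM2l //.
    have QE : Q%:R = 2 * (r%:R + 1) :> rat by rewrite /Q natrM natr1.
    by rewrite mulrC ler_pdivrMr ?ltr0n // QE; lra.
  have vz : (hgt (v r))%:R <= (hgt z)%:R :> rat by rewrite ler_nat rmin.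
  have : (hgt (v r))%:R <= 2 * (k%:R * M / `|c r|) by lra.
  move=> h; rewrite mulrC -ler_pdivlMr //; apply: le_trans h _.
  rewrite mulrA ler_wpM2r ?invr_ge0 // mulrA ler_wpM2r //.
  by rewrite -natrM ler_nat leq_mul2l kQ orbT.
have KT : 0 <= (K * T.+1)%:R * M by rewrite mulr_ge0.
have TM : 0 <= T%:R * M by rewrite mulr_ge0.
move=> j; rewrite ltnS leq_eqVlt natrD mulrDl => /orP[/eqP->|jr]; first by lra.
have := IH V v gvr c (T.+1%:R * M) _ j jr.
rewrite mulrA -natrM => h; apply: le_trans (h _) _; last by lra.
move=> i; have := hM i; rewrite big_ord_recr /= mxE => hi.
set s := (X in `|X|) in hi *.
rewrite -[X in `|X|](addrK ((c r *: toQ (v r)) 0 i)).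
apply: le_trans (ler_normB _ _) _; rewrite -natr1 mulrDl mul1r addrC.
apply: lerD => //; rewrite mxE normrM; apply: le_trans top.
by rewrite ler_wpM2l // coord_le_hgt.
Qed.

(** Successive minima span a sublattice of bounded index: by Dirichlet some
    multiple [k * z] has coordinates within 1 / (r+1) of integers.  The
    difference is an integral vector with all coordinates below 1 / (r+1); if
    [i] were the last nonzero one, it would be shorter than [v i] and outside the
    span of the earlier vectors. *)
Lemma greedy_denominator r : exists2 K : nat, (0 < K)%N &
  forall V v, greedy V r v -> forall (c : nat -> rat) z, toQ z \in V ->
  toQ z = \sum_(j < r) c j *: toQ (v j) ->
  forall j, (j < r)%N -> exists a : int, K%:R * c j = a%:~R.
Proof.
exists (r.+1 ^ r)`!; first exact: fact_gt0.
move=> V v gv c z zV zE.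
have [k [k0 kQ [m hm]]] := @dirichlet r r.+1 c isT.
pose g j := k%:R * c j - (m j)%:~R.
have g0 j : (j < r)%N -> g j = 0.
  move=> jr; apply: contrapT => /eqP gj.
  have ex : exists i, (i < r)%N && (g i != 0) by exists j; rewrite jr.
  have bd i : (i < r)%N && (g i != 0) -> (i <= r)%N by case/andP=> /ltnW.
  case: (ex_maxnP ex bd) => i /andP[ir gi] imax.
  pose w := z *+ k - \sum_(j < r) m j *: v j.
  have wE : toQ w = \sum_(l < i) g l *: toQ (v l) + g i *: toQ (v i).
    rewrite /w raddfB raddf_sum raddfMn /= zE -scaler_nat scaler_sumr -sumrB.
    rewrite -(big_mkord xpredT (fun j => k%:R *: (c j *: toQ (v j)) - toQ (m j *: v j))).
    rewrite (big_cat_nat _ (n := i.+1)) //= [X in _ + X]big_nat_cond.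
    rewrite [X in _ + X]big1 ?addr0 => [|l /andP[/andP[il lr] _]].
      rewrite big_mkord big_ord_recr /=; congr (_ + _).
        apply: eq_bigr => l _; by rewrite toQZ scalerA -scalerBl.
      by rewrite toQZ scalerA -scalerBl.
    rewrite toQZ scalerA -scalerBl -/(g l).
    have [->|gl] := eqVneq (g l) 0; first by rewrite scale0r.
    by have := imax l; rewrite lr gl leqNgt il => /(_ isT).
  have [iV iW imin] := gv i ir.
  have wV : toQ w \in V.
    rewrite /w raddfB raddf_sum raddfMn /=; apply: rpredB; first exact: rpredMn.
    apply: memv_suml => l _; rewrite toQZ memvZ //.
    by case: (gv l (ltn_ord l)).
  have wW : toQ w \notin prev_span v i.
    rewrite wE; apply: contra iW => h.
    have := memvB h (sum_prev_span v g i); rewrite addrC addKr.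
    by move/(memvZ (g i)^-1); rewrite scalerA mulVf // scale1r.
  have := imin w wV wW; apply/negP; rewrite -ltnNge.
  have hv := greedy_hgt_gt0 gv ir.
  rewrite -(ltr_nat rat); apply: (@le_lt_trans _ _
    (i.+1%:R * (hgt (v i))%:R / r.+1%:R)); last first.
    rewrite ltr_pdivrMr ?ltr0n // mulrC ltr_pM2l ?ltr0n // ltr_nat.
    by rewrite ltnS.
  apply: hgt_le_coord => [|l]; first by rewrite divr_ge0 // mulr_ge0.
  have wE' : toQ w = \sum_(l < i.+1) g l *: toQ (v l) by rewrite big_ord_recr.
  rewrite wE' summxE; apply: le_trans (ler_norm_sum _ _ _) _.
  apply: le_trans (_ : \sum_(j < i.+1) (hgt (v i))%:R / r.+1%:R <= _).
    apply: ler_sum => p _; rewrite mxE normrM mulrC.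
    have pr : (p < r)%N by apply: leq_ltn_trans ir; rewrite -ltnS.
    apply: ler_pM => //; last first.
      rewrite -[leRHS]mul1r ler_pdivlMr ?ltr0n //.
      by apply: ltW; apply: hm.
    apply: le_trans (coord_le_hgt _ _) _.
    by rewrite ler_nat (greedy_hgt_mono gv) // -ltnS.
  by rewrite sumr_const card_ord -[leLHS]mulr_natl mulrA.
move=> j jr; have /eqP := g0 j jr; rewrite subr_eq0 => /eqP e.
have kd : (k %| (r.+1 ^ r)`!)%N by apply: dvdn_fact; rewrite k0 kQ.
exists (((r.+1 ^ r)`! %/ k)%N%:Z * m j).
by rewrite rmorphM /= -e mulrA -natrM divnK.
Qed.

End Reduced.

(** * Coordinates in a reduced basis *)
Definition dot N (b x : 'rV[rat]_N) : rat := (x *m b^T) 0 0.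

Lemma dot_is_linear N (b : 'rV[rat]_N) : scalar (dot b).
Proof. by move=> a u v; rewrite /dot mulmxDl -scalemxAl !mxE. Qed.

HB.instance Definition _ N (b : 'rV[rat]_N) :=
  GRing.isLinear.Build _ _ _ _ (dot b) (dot_is_linear b).

Lemma dot_sum N I (r : seq I) (P : pred I) (a : I -> rat) (b : I -> 'rV[rat]_N) x :
  dot (\sum_(i <- r | P i) a i *: b i) x = \sum_(i <- r | P i) a i * dot (b i) x.
Proof.
rewrite /dot raddf_sum mulmx_sumr summxE; apply: eq_bigr => i _.
by rewrite /= linearZ -scalemxAr mxE.
Qed.

Lemma dot_of_scalar N (phi : {scalar 'rV[rat]_N}) :
  exists b, forall x, dot b x = phi x.
Proof.
exists (\row_l phi (delta_mx 0 l)) => x.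
rewrite [in RHS](row_sum_delta x) linear_sum /dot !mxE; apply: eq_bigr => l _.
by rewrite !mxE linearZ.
Qed.

Lemma dual_basis N r (w : nat -> 'rV[rat]_N) : free (mkseq w r) ->
  exists b : nat -> 'rV[rat]_N,
    forall i j, (i < r)%N -> (j < r)%N -> dot (b i) (w j) = (i == j)%:R.
Proof.
move=> fr; pose X : r.-tuple 'rV[rat]_N := [tuple of mkseq w r].
have ex i : exists b, forall j, (i < r)%N -> (j < r)%N ->
    dot b (w j) = (i == j)%:R.
  have [ir|ri] := ltnP i r; last by exists 0.
  have [b hb] := dot_of_scalar (coord X (Ordinal ir)); exists b => j _ jr.
  have := coord_free (Ordinal jr) (Ordinal ir) (fr : free X).
  by rewrite (nth_mkseq 0 w jr) eq_sym => e; rewrite hb; exact: e.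
exists (fun i => sval (cid (ex i))) => i j.
exact: (svalP (cid (ex i))).
Qed.

(** [b] is dual to [v] on [V].  The multiples by [K] of the coordinates of an
    integral vector are integers, bounded as if the [v j] were orthogonal, and
    vectors shorter than [v j] have no component along [v j]. *)
Definition reduced N K (V : {vspace 'rV[rat]_N}) (v : nat -> 'rV[int]_N)
    (b : nat -> 'rV[rat]_N) :=
  [/\ forall j, (j < \dim V)%N -> toQ (v j) \in V /\ (0 < hgt (v j))%N,
      forall i j, (i < \dim V)%N -> (j < \dim V)%N ->
        dot (b i) (toQ (v j)) = (i == j)%:R,
      forall x, x \in V -> x = \sum_(j < \dim V) dot (b j) x *: toQ (v j),
      forall z j, toQ z \in V -> (j < \dim V)%N ->
        exists2 a : int, K%:R * dot (b j) (toQ z) = a%:~R &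
          (`|a| * hgt (v j) <= K ^ 2 * hgt z)%N &
      forall z j, toQ z \in V -> (j < \dim V)%N -> (hgt z < hgt (v j))%N ->
        dot (b j) (toQ z) = 0].

(** The constant is the product over all dimensions of the index bound and the
    reducedness bound, so that it depends on [N] only. *)
Theorem reduced_basis N : exists2 K : nat, (0 < K)%N &
  forall V : {vspace 'rV[rat]_N}, exists v b, reduced K V v b.
Proof.
have kd r : exists2 K : nat, (0 < K)%N & forall (V : {vspace 'rV[rat]_N}) v,
    greedy V r v -> \dim V = r -> exists b, reduced K V v b.
  have [K1 h1] := greedy_coef N r; have [K2 K20 h2] := greedy_denominator N r.
  exists (K2 * K1.+1)%N; first by rewrite muln_gt0 K20.
  move=> V v gv dV.
  have sV : prev_span v r = V by move: gv; rewrite -dV; exact: greedy_span.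
  have fr : free (mkseq (fun i => toQ (v i)) r).
    by rewrite /free -/(prev_span v r) (dim_greedy gv) size_mkseq.
  have [b bP] := dual_basis fr.
  have dec x : x \in V -> x = \sum_(j < r) dot (b j) x *: toQ (v j).
    rewrite -{1}sV => /prev_spanP[c ->]; apply: eq_bigr => j _.
    rewrite linear_sum /= (bigD1 j) //= big1 ?addr0 => [|i ij].
      by rewrite linearZ /= bP // eqxx mulr1.
    by rewrite linearZ /= bP // eq_sym (negPf (ij : val i != val j)) mulr0.
  exists b; rewrite /reduced dV; split=> //.
  - move=> j jr; have [jV _ _] := gv j jr.
    by rewrite jV (greedy_hgt_gt0 gv).
  - move=> z j zV jr; have [a aE] := h2 V v gv (fun j => dot (b j) (toQ z)) z zV
      (dec _ zV) j jr.
    move: aE => /= aE; exists (K1.+1%:Z * a).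
      by rewrite natrM mulrAC aE [LHS]mulrC rmorphM.
    have /(_ (hgt z)%:R) := h1 V v gv (fun j => dot (b j) (toQ z)).
    rewrite -dec // => /(_ (coord_le_hgt z) j jr) h.
    have -> : (absz (K1.+1%:Z * a)%R * hgt (v j) =
        K1.+1 * (absz a * hgt (v j)))%N by rewrite abszM mulnA.
    rewrite -(ler_nat rat) natrM natrM natr_absz intr_norm -aE normrM.
    rewrite (ger0_norm (ler0n _ K2)) -[_ * (hgt (v j))%:R]mulrA.
    have -> : ((K2 * K1.+1) ^ 2 * hgt z = K1.+1 * (K2 * ((K2 * K1.+1) * hgt z)))%N.
      by ring.
    rewrite natrM ler_wpM2l // natrM ler_wpM2l //; apply: le_trans h _.
    rewrite -natrM ler_nat leq_mul2r; apply/orP; right.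
    by rewrite (leq_trans (leqnSn K1)) // leq_pmull.
  move=> z j zV jr hz; have [_ _ vmin] := gv j jr.
  have : toQ z \in prev_span v j.
    by apply: contraLR hz => zW; rewrite -leqNgt vmin.
  move=> /prev_spanP[c ->]; rewrite linear_sum /= big1 // => i _.
  have ij : (i < j)%N by [].
  by rewrite linearZ /= bP ?(ltn_trans ij) // gtn_eqF ?mulr0.
pose K r := s2val (cid2 (kd r)).
have K0 r : (0 < K r)%N := s2valP (cid2 (kd r)).
have KP r (V : {vspace 'rV[rat]_N}) v : greedy V r v -> \dim V = r ->
  exists b, reduced (K r) V v b := s2valP' (cid2 (kd r)) V v.
pose KN := (\prod_(r < N.+1) K r)%N.
exists KN; first by rewrite prodn_gt0.
move=> V; have [v gv] := greedy_exists (leqnn (\dim V)).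
have [b [b1 b2 b3 b4 b5]] := KP _ V v gv erefl.
exists v, b; split=> // z j zV jr.
have dN : (\dim V < N.+1)%N.
  by rewrite ltnS (leq_trans (dimvS (subvf V))) // dimvf /dim /= mul1n.
have [m KE] : exists m, (KN = m * K (\dim V))%N.
  apply/dvdnP; rewrite /KN (bigD1 (Ordinal dN)) //=; exact: dvdn_mulr.
have m0 : (0 < m)%N.
  by have : (0 < KN)%N by [rewrite prodn_gt0]; rewrite KE muln_gt0 => /andP[].
have [a aE ale] := b4 z j zV jr; exists (m%:Z * a).
  by rewrite KE natrM -mulrA aE rmorphM.
rewrite abszM -mulnA KE expnMn -mulnA -[(m ^ 2)%N]/(m * m)%N -mulnA.
by rewrite leq_mul2l; apply/orP; right; apply: leq_trans ale _; rewrite leq_pmull.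
Qed.

(** * Counting points and hyperplanes *)
Section FewLines.
Variables (R : numDomainType) (N : nat).
Implicit Types (A B : 'rV[rat]_N -> Prop) (a b : R).

Lemma few_lines_sub A B b : (forall x, x != 0 -> A x -> B x) ->
  few_lines B b -> few_lines A b.
Proof.
move=> AB hB s us hs; apply: hB => // L /hs[x [nx Ax Lx]].
by exists x; split=> //; apply: AB.
Qed.

Lemma few_lines_le A a b : a <= b -> few_lines A a -> few_lines A b.
Proof. by move=> ab hA s us hs; apply: le_trans (hA s us hs) ab. Qed.

Lemma few_lines0 A b : 0 <= b -> (forall x, x != 0 -> ~ A x) -> few_lines A b.
Proof.
move=> b0 nA s us hs; case: s hs {us} => [//|L s] hs.
have [|x [nx /nA]] := hs L; first by rewrite inE eqxx.
by move/(_ nx).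
Qed.

Lemma few_lines_setU A B a b : few_lines A a -> few_lines B b ->
  few_lines (fun x => A x \/ B x) (a + b).
Proof.
move=> hA hB s us hs.
pose P (L : {vspace 'rV[rat]_N}) := `[< exists x, [/\ x != 0, A x & L = <[x]>%VS] >].
rewrite -(count_predC P) natrD; apply: lerD.
  rewrite -size_filter; apply: hA; first exact: filter_uniq.
  by move=> L; rewrite mem_filter => /andP[/asboolP].
rewrite -size_filter; apply: hB; first exact: filter_uniq.
move=> L; rewrite mem_filter /= => /andP[/asboolP nP /hs[x [nx [Ax|Bx] Lx]]].
  by case: nP; exists x.
by exists x.
Qed.

Lemma few_lines_bigU (I : eqType) (r : seq I) (A : I -> 'rV[rat]_N -> Prop)
    (b : I -> R) : (forall i, i \in r -> few_lines (A i) (b i)) ->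
  few_lines (fun x => exists2 i, i \in r & A i x) (\sum_(i <- r) b i).
Proof.
elim: r => [|i r IH] h.
  by rewrite big_nil; apply: few_lines0 => // x _ [].
rewrite big_cons; apply: (@few_lines_sub _
    (fun x => A i x \/ exists2 j, j \in r & A j x)).
  move=> x _ [j]; rewrite inE => /orP[/eqP->|jr] Ajx; [by left|right].
  by exists j.
apply: few_lines_setU; first by apply: h; rewrite mem_head.
by apply: IH => j jr; apply: h; rewrite inE jr orbT.
Qed.

Lemma few_lines_list (t : seq 'rV[rat]_N) :
  few_lines (fun x => exists2 w, w \in t & <[x]>%VS = <[w]>%VS) ((size t)%:R : R).
Proof.
move=> s us hs; rewrite ler_nat.
rewrite -(size_map (fun w => <[w]>%VS)); apply: uniq_leq_size => // L /hs.
by move=> [x [_ [w wt xw] ->]]; rewrite xw; apply: map_f.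
Qed.

End FewLines.

Definition irange Y : seq int := [seq (i%:Z - Y%:Z) | i <- iota 0 (2 * Y).+1].

Lemma mem_irange Y (a : int) : (a \in irange Y) = (absz a <= Y)%N.
Proof.
apply/mapP/idP => [[i]|aY]; first by rewrite mem_iota => /andP[_ h] ->; lia.
by exists (absz (a + Y%:Z)); rewrite ?mem_iota; lia.
Qed.

Lemma size_irange Y : size (irange Y) = (2 * Y).+1.
Proof. by rewrite size_map size_iota. Qed.

Fixpoint combinations (U : zmodType) (v : nat -> U) (Y : nat -> nat) r : seq U :=
  if r is r'.+1 then
    [seq w + v r' *~ a | w <- combinations v Y r', a <- irange (Y r')]
  else [:: 0].

Lemma size_combinations (U : zmodType) (v : nat -> U) Y r :
  size (combinations v Y r) = (\prod_(j < r) (2 * Y j).+1)%N.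
Proof.
elim: r => [|r IH]; first by rewrite big_ord0.
by rewrite big_ord_recr -IH -size_irange; exact: (size_allpairs (fun w a => w + v r *~ a)).
Qed.

Lemma mem_combinations (U : zmodType) (v : nat -> U) Y r (a : nat -> int) :
  (forall j, (j < r)%N -> (absz (a j) <= Y j)%N) ->
  \sum_(j < r) v j *~ a j \in combinations v Y r.
Proof.
elim: r => [|r IH] h; first by rewrite big_ord0 inE.
rewrite big_ord_recr; apply: (allpairs_f (fun w a => w + v r *~ a)).
  by apply: IH => j jr; apply: h; apply: ltnW.
by rewrite mem_irange h.
Qed.

Definition bounded N (m : nat) (x : 'rV[rat]_N) :=
  exists2 z, x = toQ z & (hgt z <= m)%N.

(** Integral vectors whose coordinates in the tuple [v] are as those of vectors of
    height at most [m] in a reduced basis.  The condition depends on [v] only, so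
    that the subspaces can be enumerated by their tuples. *)
Definition in_box N K r m (v : nat -> 'rV[int]_N) (x : 'rV[rat]_N) :=
  exists z (a : nat -> int), [/\ x = toQ z, z *+ K = \sum_(j < r) v j *~ a j &
    forall j, (j < r)%N -> (absz (a j) * hgt (v j) <= K ^ 2 * m)%N].

Lemma line_scale N (x : 'rV[rat]_N) (k : rat) : k != 0 ->
  <[k *: x]>%VS = <[x]>%VS.
Proof.
move=> k0; apply/vspaceP => y; apply/vlineP/vlineP => -[c ->].
  by exists (c * k); rewrite scalerA.
by exists (c / k); rewrite scalerA divfK.
Qed.

Lemma few_lines_in_box (R : numDomainType) N K r m (v : nat -> 'rV[int]_N) :
  (0 < K)%N -> (forall j, (j < r)%N -> (0 < hgt (v j))%N) ->
  few_lines (in_box K r m v)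
    ((\prod_(j < r) (2 * ((K ^ 2 * m) %/ hgt (v j))).+1)%N%:R : R).
Proof.
move=> K0 hv; rewrite -(size_combinations v (fun j => (K ^ 2 * m) %/ hgt (v j))%N).
rewrite -(size_map (@toQ N)).
apply: (few_lines_sub _ (@few_lines_list _ _ _)) => x _ [z [a [-> zK ha]]].
exists (toQ (z *+ K)).
  apply/map_f; rewrite zK; apply: mem_combinations => j jr.
  by rewrite leq_divRL ?hv // ha.
by rewrite raddfMn /= -scaler_nat line_scale // pnatr_eq0 -lt0n.
Qed.

(** Siegel's lemma for one equation, by the pigeonhole principle: the sum of the
    [a j * y j] takes values in an interval that is shorter than the number of
    choices of [a]. *)
Lemma pigeonhole_relation q (M : nat -> nat) (Y : nat -> nat) (y : nat -> int) :
  (forall j, (j < q)%N -> (absz (y j) <= Y j)%N) ->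
  ((2 * \sum_(j < q) M j * Y j).+1 < \prod_(j < q) (M j).+1)%N ->
  exists a : nat -> int, [/\ forall j, (j < q)%N -> (absz (a j) <= M j)%N,
    exists2 j, (j < q)%N & a j != 0 & \sum_(j < q) a j * y j = 0].
Proof.
move=> hy lt; pose T := (\sum_(j < q) M j * Y j)%N.
pose D := {dffun forall j : 'I_q, 'I_(M j).+1}.
pose val_of (f : D) : int := \sum_(j < q) (f j)%:Z * y j.
have vb f : (absz (val_of f) <= T)%N.
  rewrite -lez_nat abszE; apply: le_trans (ler_norm_sum _ _ _) _.
  rewrite /T -natz natr_sum; apply: ler_sum => j _.
  rewrite normrM -!abszE natz -PoszM lez_nat absz_nat leq_mul //.
    by rewrite -ltnS ltn_ord.
  exact: hy.
have cardD : #|D| = (\prod_(j < q) (M j).+1)%N.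
  rewrite card_dep_ffun foldrE big_image /=.
  by apply: eq_bigr => j _; rewrite card_ord.
have idx f : (index (val_of f) (irange T) < (2 * T).+1)%N.
  by rewrite -size_irange index_mem mem_irange.
pose g f := Ordinal (idx f).
have [f1 [f2 [f12 g12]]] : exists f1 f2, f1 != f2 /\ g f1 = g f2.
  have ninj : ~ injective g.
    by move/leq_card; rewrite card_ord cardD leqNgt lt.
  apply: contrapT => no; apply: ninj => f1 f2 e; apply/eqP.
  by apply: contraT => ne; case: no; exists f1, f2.
have e12 : val_of f1 = val_of f2.
  have := congr1 val g12 => /= /(congr1 (nth 0 (irange T))).
  by rewrite !nth_index ?mem_irange.
pose a j : int := if insub j is Some i then (f1 i)%:Z - (f2 i)%:Z else 0.
have aE (j : 'I_q) : a j = (f1 j)%:Z - (f2 j)%:Z by rewrite /a valK.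
exists a; split.
- move=> j jq; rewrite (aE (Ordinal jq)).
  have := ltn_ord (f1 (Ordinal jq)); have := ltn_ord (f2 (Ordinal jq)) => /=.
  move: (f1 _) (f2 _) => [u1 h1] [u2 h2] /=; lia.
- apply: contrapT => h; move/eqP: f12; apply; apply/ffunP => j; apply: val_inj.
  have : a j = 0.
    by apply/eqP; apply: contraT => aj; case: h; exists j.
  by rewrite aE => /eqP; rewrite subr_eq0 => /eqP [].
have -> : \sum_(j < q) a j * y j = val_of f1 - val_of f2.
  by rewrite -sumrB; apply: eq_bigr => j _; rewrite aE mulrBl.
by rewrite e12 subrr.
Qed.

(** Siegel's lemma relative to [V]: it applies to the first [q] coordinates of a
    point in the reduced basis, and the relation that it gives is a linear form
    that does not vanish on [V]. *)
Lemma few_lines_hyperplanes (R : numDomainType) N K (V : {vspace 'rV[rat]_N}) v b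
    (Z : 'rV[rat]_N -> Prop) (e : R) m q (M : nat -> nat) :
  (0 < K)%N -> reduced K V v b -> 0 <= e -> (q <= \dim V)%N ->
  (forall x, Z x -> x \in V) ->
  (forall (phi : {scalar 'rV[rat]_N}) w, w \in V -> phi w != 0 ->
     few_lines (fun x => Z x /\ phi x = 0) e) ->
  ((2 * \sum_(j < q) M j * ((K ^ 2 * m) %/ hgt (v j))).+1
     < \prod_(j < q) (M j).+1)%N ->
  few_lines (fun x => Z x /\ bounded m x)
    (e * (\prod_(j < q) (2 * M j).+1)%N%:R).
Proof.
move=> K0 [b1 b2 b3 b4 b5] e0 qV ZV hZ lt.
rewrite -(size_combinations b M) mulr_natr.
set t := combinations b M q.
have <- : \sum_(beta <- t) e = e *+ size t.
  by rewrite big_const_seq count_predT iter_addr_0.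
have bU := @few_lines_bigU R N _ t (fun beta x => Z x /\ dot beta x = 0 /\
  exists2 w, w \in V & dot beta w != 0) (fun=> e).
apply: (few_lines_sub _ (bU _)); last first.
  move=> beta _; have [[w wV bw]|no] := pselect (exists2 w, w \in V & dot beta w != 0).
    apply: (few_lines_sub _ (hZ (dot beta) w wV bw)) => x _ [Zx [bx _]] //.
  by apply: few_lines0 => // x _ [_ [_ h]]; apply: no.
move=> x _ [Zx [z xz hz]].
have zV : toQ z \in V by rewrite -xz; apply: ZV.
have ex j : exists a : int, (j < \dim V)%N ->
    K%:R * dot (b j) (toQ z) = a%:~R /\ (absz a <= (K ^ 2 * m) %/ hgt (v j))%N.
  have [jV|jV] := ltnP j (\dim V); last by exists 0.
  have [a aE ale] := b4 z j zV jV; exists a => _; split=> //.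
  rewrite leq_divRL; last by have [] := b1 j jV.
  by apply: leq_trans ale _; rewrite leq_mul2l hz orbT.
pose y j := sval (cid (ex j)).
have yP j (jq : (j < q)%N) : K%:R * dot (b j) (toQ z) = (y j)%:~R /\
    (absz (y j) <= (K ^ 2 * m) %/ hgt (v j))%N.
  by apply: (svalP (cid (ex j))); apply: leq_trans jq qV.
have [|a [aM [j0 j0q aj0] a0]] := @pigeonhole_relation q M
  (fun j => (K ^ 2 * m) %/ hgt (v j))%N y _ lt.
  by move=> j /yP[].
exists (\sum_(j < q) b j *~ a j); first exact: mem_combinations.
have dotE w : dot (\sum_(j < q) b j *~ a j) w = \sum_(j < q) (a j)%:~R * dot (b j) w.
  by rewrite -dot_sum; congr dot; apply: eq_bigr => j _; rewrite scaler_int.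
split=> //; split.
  have KQ : K%:R != 0 :> rat by rewrite pnatr_eq0 -lt0n.
  rewrite xz dotE; apply: (mulfI KQ); rewrite mulr0.
  have := congr1 (intr : int -> rat) a0; rewrite /= mulr0z (raddf_sum intr) mulr_sumr => h.
  apply: etrans h; apply: eq_bigr => j _; have [yE _] := yP j (ltn_ord j).
  by rewrite mulrCA yE /= intrM.
exists (toQ (v j0)); first by have [] := b1 j0 (leq_trans j0q qV).
rewrite dotE (bigD1 (Ordinal j0q)) //= big1 ?addr0 => [|j jj].
  by rewrite b2 ?(leq_trans j0q) // eqxx mulr1 intr_eq0.
rewrite b2 ?(leq_trans (ltn_ord j)) ?(leq_trans j0q) //.
by rewrite (negPf (jj : val j != j0)) mulr0.
Qed.

(** * Sums over integral vectors *)
Section Box.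
Variable N : nat.

Definition box (m : nat) : seq 'rV[int]_N :=
  [seq \row_i ((nat_of_ord (f i))%:Z - m%:Z) | f : {ffun 'I_N -> 'I_(2 * m).+1}].

Lemma mem_box m z : (z \in box m) = (hgt z <= m)%N.
Proof.
apply/mapP/hgtP => [[f _ ->] i|h].
  by rewrite mxE; case: (f i) => u hu /=; lia.
exists [ffun i => inord (absz (z 0%R i + m%:Z)%R)]; first by rewrite mem_enum.
by apply/rowP => i; rewrite mxE ffunE; move: (h i); move: (z 0 i) => u hu;
  rewrite inordK; lia.
Qed.

Lemma box_uniq m : uniq (box m).
Proof.
rewrite map_inj_uniq ?enum_uniq // => f g /rowP e; apply/ffunP => i.
by apply: val_inj; have := e i; rewrite !mxE => /addIr [].
Qed.

Lemma size_box m : size (box m) = ((2 * m).+1 ^ N)%N.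
Proof. by rewrite size_map -cardE card_ffun !card_ord. Qed.

Lemma box_split m :
  perm_eq (box m.+1) (box m ++ [seq z <- box m.+1 | hgt z == m.+1]).
Proof.
rewrite -(perm_filterC (fun z => hgt z <= m)%N (box m.+1)) perm_sym.
apply: perm_cat; last first.
  rewrite (_ : [seq z <- _ | hgt z == _] =
    [seq z <- box m.+1 | predC (fun z => hgt z <= m)%N z]) //.
  apply: eq_in_filter => z.
  by rewrite mem_box /= -ltnNge eqn_leq => ->.
apply: uniq_perm; rewrite ?filter_uniq ?box_uniq // => z.
by rewrite mem_filter !mem_box andb_idr // => /leqW.
Qed.

Lemma sum_box (R : pzRingType) (F : nat -> R) m :
  \sum_(z <- box m | z != 0) F (hgt z) =
  \sum_(1 <= h < m.+1) ((2 * h).+1 ^ N - (2 * h.-1).+1 ^ N)%N%:R * F h.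
Proof.
elim: m => [|m IH].
  rewrite big_geq // big_seq_cond big1 // => z; rewrite mem_box leqn0 hgt_eq0.
  by case: eqP.
rewrite big_nat_recr //= -IH (perm_big _ (box_split m)) big_cat /=; congr (_ + _).
set sh := [seq z <- _ | _].
have -> : ((2 * m.+1).+1 ^ N - (2 * m).+1 ^ N = size sh)%N.
  by rewrite -!size_box (perm_size (box_split m)) size_cat addKn.
transitivity (\sum_(z <- sh) F m.+1).
  rewrite big_mkcond; apply: eq_big_seq => z; rewrite mem_filter => /andP[/eqP hz _].
  by rewrite -hgt_eq0 hz.
by rewrite big_const_seq count_predT iter_addr_0 mulr_natl.
Qed.

End Box.

(** With [b = 2 * h - 1] this bounds the number of integral vectors of height [h],
    which fill the shell between two boxes of sides [b] and [b.+2]. *)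
Lemma expn_shell n b : (b.+2 ^ n.+1 <= b ^ n.+1 + 2 * n.+1 * b.+2 ^ n)%N.
Proof.
elim: n => [|n IH]; first by rewrite !expn1 expn0; lia.
rewrite expnS; apply: leq_trans (leq_mul (leqnn b.+2) IH) _.
have le : (b ^ n.+1 <= b.+2 ^ n.+1)%N by rewrite leq_exp2r //; lia.
have e1 : (b ^ n.+2 = b * b ^ n.+1)%N by rewrite expnS.
have e2 : (b.+2 ^ n.+1 = b.+2 * b.+2 ^ n)%N by rewrite expnS.
rewrite e1; nia.
Qed.

Lemma harmonic_le_ln (R : realType) m :
  \sum_(1 <= h < m.+2) (h%:R : R)^-1 <= 1 + ln (m.+1)%:R.
Proof.
elim: m => [|m IH]; first by rewrite big_nat1 invr1 ln1 addr0.
rewrite big_nat_recr //=; apply: le_trans (lerD IH (lexx _)) _.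
rewrite -addrA lerD2l.
have p1 : (0 : R) < m.+1%:R by rewrite ltr0n.
have p2 : (0 : R) < m.+2%:R by rewrite ltr0n.
have := @le_ln1Dx R (- (m.+2%:R)^-1).
have -> : 1 + - (m.+2%:R)^-1 = m.+1%:R / m.+2%:R :> R.
  have nz : m.+2%:R != 0 :> R by rewrite gt_eqF.
  by rewrite -[X in X - _](divff nz) -[X in _ - X]mul1r -mulrBl -[X in X - 1]natr1 addrK.
rewrite ln_div ?posrE // => h.
have : ln m.+1%:R - ln m.+2%:R <= - m.+2%:R^-1 :> R.
  by apply: h; rewrite ltrN2 invf_lt1 // ltr1n.
move: (m.+2%:R^-1) (ln m.+1%:R) (ln m.+2%:R) => a b c; lra.
Qed.

(** There are about [h ^ n] vectors of height [h], so this is a harmonic sum. *)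
Lemma height_sum (R : realType) n m : (0 < m)%N ->
  \sum_(z <- box n.+1 m | z != 0) ((hgt z)%:R ^+ n.+1)^-1 <=
  (2 * n.+1 * 3 ^ n)%N%:R * (1 + ln m%:R) :> R.
Proof.
case: m => // m _; rewrite (sum_box _ (fun h => (h%:R ^+ n.+1)^-1)).
apply: le_trans (ler_wpM2l (ler0n _ _) (harmonic_le_ln R m)).
rewrite mulr_sumr !big_nat; apply: ler_sum => h /andP[h0 _].
have hp : (0 : R) < h%:R by rewrite ltr0n.
rewrite -ler_pdivlMr ?invr_gt0 ?exprn_gt0 // invrK exprS mulrA.
rewrite -[_ / _ * _]mulrA mulVf ?gt_eqF // mulr1 -natrX -natrM ler_nat.
rewrite leq_subLR.
have -> : ((2 * h).+1 = (2 * h.-1).+1.+2)%N by lia.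
apply: leq_trans (expn_shell _ _) _; rewrite leq_add2l -[X in (_ <= X)%N]mulnA leq_mul2l.
by apply/orP; right; rewrite -expnMn; case: n => // n; rewrite leq_exp2r //; lia.
Qed.

(** * Points on one component *)

(** Shrinks the factors of a product to prescribe its value; heights of basis
    vectors are lowered in this way when their product is larger than useful. *)
Lemma split_product (R : realFieldType) q (h : nat -> R) (L : R) :
  (forall j, (j < q)%N -> 1 <= h j) -> 1 <= L -> L <= \prod_(j < q) h j ->
  exists l : nat -> R, (forall j, (j < q)%N -> 1 <= l j <= h j) /\
    \prod_(j < q) l j = L.
Proof.
elim: q L => [|q IH] L h1 L1.
  rewrite big_ord0 => L2; exists h; split=> //; rewrite big_ord0.
  by apply/eqP; rewrite eq_le L1 L2.
rewrite big_ord_recr /= => LP; set P := \prod_(j < q) h j in LP.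
have h1' j : (j < q)%N -> 1 <= h j by move=> jq; rewrite h1 // ltnW.
have P1 : 1 <= P.
  by apply: (big_ind (fun x => 1 <= x)) => // [x y x1 y1|j _];
    [rewrite -[leLHS]mulr1 ler_pM|exact: h1'].
have [LP'|PL] := leP L P.
  have [l [l1 lL]] := IH L h1' L1 LP'.
  exists (fun j => if (j < q)%N then l j else 1); split=> [j jq|].
    case: ifP => [/l1 //|_]; by rewrite lexx h1.
  rewrite big_ord_recr /= ltnn mulr1 -lL; apply: eq_bigr => j _.
  by rewrite ltn_ord.
have P0 : 0 < P by apply: lt_le_trans P1.
exists (fun j => if (j < q)%N then h j else L / P); split=> [j jq|].
  have [jq'|qj] := ltnP j q; first by rewrite h1' //= lexx.
  have -> : j = q by apply/eqP; rewrite eqn_leq qj andbT -ltnS.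
  by rewrite ler_pdivlMr // mul1r ltW //= ler_pdivrMr // mulrC.
rewrite big_ord_recr /= ltnn; have -> : \prod_(j < q) (if (j < q)%N then h j else L / P) = P.
  by apply: eq_bigr => j _; rewrite ltn_ord.
by rewrite mulrC divfK // gt_eqF.
Qed.

Section Count.
Variables (R : realType) (n K m : nat).
Hypotheses (K0 : (0 < K)%N) (m0 : (0 < m)%N).
Let N := n.+1.
Let mu : R := m%:R.
Let S : R := \sum_(z <- box N m | z != 0) ((hgt z)%:R ^+ n.+1)^-1.
Let D : R := 3 * K%:R ^+ 2 * mu.

Let mu1 : 1 <= mu. Proof. by rewrite ler1n. Qed.

Lemma box_size_le r (v : nat -> 'rV[int]_N) :
  (forall j, (j < r)%N -> (0 < hgt (v j) <= m)%N) ->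
  (\prod_(j < r) (2 * ((K ^ 2 * m) %/ hgt (v j))).+1)%N%:R <=
  D ^+ r / (\prod_(j < r) hgt (v j))%N%:R.
Proof.
move=> hv; rewrite !natr_prod.
rewrite (_ : D ^+ r = \prod_(j < r) D); last by rewrite prodr_const card_ord.
rewrite -prodf_div; apply: ler_prod => j _; rewrite ler0n /=.
have /andP[h0 hm] := hv j (ltn_ord j).
have hp : (0 : R) < (hgt (v j))%:R by rewrite ltr0n.
rewrite ler_pdivlMr // -natrM.
have -> : D = (3 * (K ^ 2 * m))%N%:R by rewrite /D natrM natrM natrX mulrA.
rewrite ler_nat mulSn.
have h1 := leq_divM (K ^ 2 * m) (hgt (v j)).
have h2 : (hgt (v j) <= K ^ 2 * m)%N.
  by apply: leq_trans hm _; rewrite leq_pmull // expn_gt0 K0.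
by rewrite -mulnA; move: h1 h2; move: (_ %/ _ * _)%N => u; lia.
Qed.

(** Points of the subspaces that have a reduced basis with product of heights at
    most [tau]. *)
Definition small_tuple_point r (tau : R) (x : 'rV[rat]_N) :=
  exists v : nat -> 'rV[int]_N,
  [/\ forall j, (j < r)%N -> (0 < hgt (v j) <= m)%N,
      (\prod_(j < r) hgt (v j))%N%:R <= tau & in_box K r m v x].

(** A tuple with product of heights A contributes at most
    D^r / A <= D^r * tau^n / A^(n+1), and the sum of A^(-n-1) over all tuples
    factors into [r] equal sums. *)
Lemma few_small_tuple_points r tau : 0 <= tau ->
  few_lines (small_tuple_point r tau) (D ^+ r * tau ^+ n * S ^+ r).
Proof.
move=> tau0.
pose E := [seq z <- box N m | z != 0].
have EP z : (z \in E) = (0 < hgt z <= m)%N.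
  by rewrite mem_filter mem_box lt0n hgt_eq0.
pose el (i : 'I_(size E)) := tnth (in_tuple E) i.
have elE i : (0 < hgt (el i) <= m)%N by rewrite -EP mem_tnth.
pose vf (f : {ffun 'I_r -> 'I_(size E)}) j :=
  if insub j is Some i then el (f i) else 0.
have vfE f (j : 'I_r) : vf f j = el (f j) by rewrite /vf valK.
pose A f : R := (\prod_(j < r) hgt (vf f j))%N%:R.
pose t := [seq f <- enum {: {ffun 'I_r -> 'I_(size E)}} | A f <= tau].
have hvf f j : (j < r)%N -> (0 < hgt (vf f j) <= m)%N.
  by move=> jr; rewrite (vfE f (Ordinal jr)).
have A0 f : 0 < A f.
  by rewrite ltr0n prodn_gt0 // => j; have /andP[] := hvf f j (ltn_ord j).
apply: (few_lines_le _ (few_lines_sub _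
  (@few_lines_bigU R N _ t (fun f => in_box K r m (vf f)) (fun f => D ^+ r / A f) _))).
- rewrite big_filter big_enum_cond /=.
  apply: (@le_trans _ _ (\sum_(f : {ffun 'I_r -> 'I_(size E)})
    D ^+ r * tau ^+ n * \prod_(j < r) ((hgt (el (f j)))%:R ^+ n.+1)^-1)).
    rewrite [leRHS](bigID (fun f => A f <= tau)) /=.
    rewrite -[leLHS]addr0; apply: lerD; last first.
      apply: sumr_ge0 => f _; rewrite !mulr_ge0 ?exprn_ge0 ?mulr_ge0 ?exprn_ge0 //.
      by apply: prodr_ge0 => j _; rewrite invr_ge0 exprn_ge0.
    apply: ler_sum => f Af; rewrite -mulrA ler_wpM2l ?exprn_ge0 ?mulr_ge0 ?exprn_ge0 //.
    have -> : \prod_(j < r) ((hgt (el (f j)))%:R ^+ n.+1)^-1 = (A f ^+ n.+1)^-1.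
      rewrite /A natr_prod -prodrXl -prodfV; apply: eq_bigr => j _.
      by rewrite vfE.
    rewrite ler_pdivlMr ?exprn_gt0 // exprS mulKf ?gt_eqF //.
    by rewrite lerXn2r ?nnegrE // ltW.
  rewrite -mulr_sumr -(bigA_distr_bigA (fun (j : 'I_r) i =>
    ((hgt (el i))%:R ^+ n.+1)^-1)) /=.
  have -> : S = \sum_i ((hgt (el i))%:R ^+ n.+1)^-1.
    by rewrite /S -big_filter -/E big_tnth.
  by rewrite prodr_const card_ord.
- move=> x _ [v [hv vt bx]].
  have jE (j : 'I_r) : (index (v j) E < size E)%N by rewrite index_mem EP hv.
  pose f := [ffun j : 'I_r => Ordinal (jE j)].
  have vv (j : 'I_r) : vf f j = v j.
    by rewrite vfE ffunE /el (tnth_nth 0) /= nth_index // EP hv.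
  have Ef : A f <= tau.
    by rewrite /A (eq_bigr (fun j : 'I_r => hgt (v j))) // => j _; rewrite vv.
  exists f; first by rewrite mem_filter Ef mem_enum.
  have [z [a [xz zK ha]]] := bx; exists z, a; split=> //.
    by rewrite zK; apply: eq_bigr => j _; rewrite vv.
  by move=> j jr; rewrite (vv (Ordinal jr)) ha.
move=> f _; apply: few_lines_le (few_lines_in_box _ _ _) => //.
  by apply: box_size_le => j; exact: hvf.
by move=> j /(hvf f)/andP[].
Qed.

Section Component.
Variables (V : {vspace 'rV[rat]_N}) (v : nat -> 'rV[int]_N) (b : nat -> 'rV[rat]_N).
Variables (Z : 'rV[rat]_N -> Prop) (e : R).
Hypotheses (red : reduced K V v b) (e1 : 1 <= e) (ZV : forall x, Z x -> x \in V)
  (hZ : forall (phi : {scalar 'rV[rat]_N}) w, w \in V -> phi w != 0 ->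
     few_lines (fun x => Z x /\ phi x = 0) e).

Let e0 : 0 <= e. Proof. by apply: le_trans e1. Qed.

Lemma in_box_of_bounded x : Z x -> bounded m x -> in_box K (\dim V) m v x.
Proof.
case: red => [r1 r2 r3 r4 r5] Zx [z xz hz].
have zV : toQ z \in V by rewrite -xz; apply: ZV.
have ex j : exists a : int, (j < \dim V)%N ->
    K%:R * dot (b j) (toQ z) = a%:~R /\ (absz a * hgt (v j) <= K ^ 2 * m)%N.
  have [jV|jV] := ltnP j (\dim V); last by exists 0.
  have [a aE ale] := r4 z j zV jV; exists a => _; split=> //.
  by apply: leq_trans ale _; rewrite leq_mul2l hz orbT.
pose a j := sval (cid (ex j)).
have aP j (jq : (j < \dim V)%N) : K%:R * dot (b j) (toQ z) = (a j)%:~R /\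
    (absz (a j) * hgt (v j) <= K ^ 2 * m)%N := svalP (cid (ex j)) jq.
exists z, a; split=> //; last by move=> j /aP[].
apply: (@toQ_inj N); rewrite raddfMn raddf_sum /= (r3 _ zV) -scaler_nat scaler_sumr.
apply: eq_bigr => j _; rewrite scalerA; have [-> _] := aP j (ltn_ord j).
by rewrite raddfMz /= scaler_int.
Qed.

(** A basis vector longer than all the points has a coordinate function that
    vanishes at all of them. *)
Lemma few_if_tall j : (j < \dim V)%N -> (m < hgt (v j))%N ->
  few_lines (fun x => Z x /\ bounded m x) e.
Proof.
case: red => [r1 r2 r3 r4 r5] jV hj.
have vj : dot (b j) (toQ (v j)) != 0 by rewrite r2 // eqxx.
have [vV _] := r1 j jV.
have h := @hZ (dot (b j)) _ vV vj.
apply: (few_lines_sub _ h) => x _ [Zx [z xz hz]].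
split=> //; rewrite xz; apply: r5 => //; first by rewrite -xz; exact: ZV.
exact: leq_ltn_trans hz hj.
Qed.

(** Relations with coefficients at most [s * l j]: there are about
    [s ^ q * \prod_j l j] of them, against about [s * mu] values. *)
Lemma few_hyperplanes q (l : nat -> R) (s : R) : (0 < q)%N -> (q <= \dim V)%N ->
  (forall j, (j < q)%N -> 1 <= l j <= (hgt (v j))%:R) -> 1 <= s ->
  (2 * q * K ^ 2).+1%:R * mu <= s ^+ q.-1 * \prod_(j < q) l j ->
  few_lines (fun x => Z x /\ bounded m x) (e * (3 ^+ q * s ^+ q * \prod_(j < q) l j)).
Proof.
move=> q0 qV hl s1 hs; have s0 : 0 < s by apply: lt_le_trans s1.
case: (red) => [r1 r2 r3 r4 r5].
have l1 (j : 'I_q) : 1 <= l j by have /andP[] := hl j (ltn_ord j).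
have sl (j : 'I_q) : 1 <= s * l j.
  by rewrite -[leLHS]mulr1 ler_pM.
have prodE : s ^+ q * \prod_(j < q) l j = \prod_(j < q) (s * l j).
  by rewrite big_split /= prodr_const card_ord.
pose M j := Num.truncn (s * l j).
have Mle (j : 'I_q) : (M j)%:R <= s * l j.
  by rewrite truncn_le //; apply: le_trans (sl j).
have Mgt (j : 'I_q) : s * l j < (M j).+1%:R by apply: truncnS_gt.
apply: few_lines_le (few_lines_hyperplanes (q := q) (M := M) K0 red e0 qV ZV hZ _).
  rewrite ler_wpM2l // -mulrA prodE natr_prod.
  rewrite (_ : 3 ^+ q = \prod_(j < q) 3); last by rewrite prodr_const card_ord.
  rewrite -big_split /=; apply: ler_prod => j _; rewrite ler0n /=.
  have := Mle j; have := sl j; rewrite -natr1 natrM; lra.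
rewrite -(ltr_nat R); apply: (@le_lt_trans _ _ (\prod_(j < q) (s * l j))); last first.
  rewrite natr_prod; apply: ltr_prod.
    by apply/hasP; exists (Ordinal q0) => //; rewrite mem_index_enum.
  by move=> j _; rewrite Mgt andbT; apply: le_trans (sl j).
have sq : s ^+ q = s ^+ q.-1 * s by rewrite -exprSr prednK.
rewrite -prodE sq mulrAC.
apply: le_trans (_ : (2 * q * K ^ 2).+1%:R * mu * s <= _); last first.
  by apply: ler_wpM2r => //; exact: ltW.
have t1 (j : 'I_q) : ((M j * ((K ^ 2 * m) %/ hgt (v j)))%N%:R : R) <= s * (K ^ 2 * m)%N%:R.
  have /andP[_ lh] := hl j (ltn_ord j).
  have [_ h0] := r1 j (leq_trans (ltn_ord j) qV).
  rewrite natrM; apply: le_trans (_ : s * (hgt (v j))%:R * ((K ^ 2 * m) %/ hgt (v j))%:R <= _).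
    rewrite ler_wpM2r //; apply: le_trans (Mle j) _.
    by rewrite ler_wpM2l // ltW.
  rewrite -mulrA ler_wpM2l ?(ltW s0) // -natrM ler_nat mulnC; exact: leq_divM.
rewrite -[X in X <= _]natr1 natrM natr_sum.
have : \sum_(j < q) ((M j * ((K ^ 2 * m) %/ hgt (v j)))%N%:R : R) <= s * (K ^ 2 * m)%N%:R *+ q.
  apply: le_trans (ler_sum _ (fun j _ => t1 j)) _.
  by rewrite sumr_const card_ord.
move=> h; apply: le_trans (lerD (ler_wpM2l (ler0n _ 2) h) (lexx 1)) _.
have -> : (2 * q * K ^ 2).+1%:R * mu * s = 2 * (s * (K ^ 2 * m)%N%:R *+ q) + mu * s.
  rewrite -[_ *+ q]mulr_natr -[(2 * q * K ^ 2).+1%:R]natr1 !natrM /mu; ring.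
by rewrite lerD2l -[leLHS]mulr1 ler_pM.
Qed.

Variables (delta rho : R).
Hypotheses (delta1 : 1 <= delta) (rho1 : 1 <= rho) (rho3 : rho ^+ 3 = mu).

Definition relation_cst q : R := (2 * q * K ^ 2).+1%:R.
(** One term for each dimension of the span: 0 or 1, line, plane, and more. *)
Definition generic_bound : R :=
  1 + D ^+ 2 / delta + 27 * relation_cst 3 ^+ 2 * mu * (mu / delta + rho)
    + 81 * relation_cst 4 ^+ 4 * mu * rho.

Let mu0 : 0 < mu. Proof. exact: lt_le_trans mu1. Qed.
Let delta0 : 0 < delta. Proof. exact: lt_le_trans delta1. Qed.
Let rho0 : 0 < rho. Proof. exact: lt_le_trans rho1. Qed.
Let C31 : 1 <= relation_cst 3. Proof. by rewrite ler1n. Qed.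
Let C41 : 1 <= relation_cst 4. Proof. by rewrite ler1n. Qed.
Let t2 : 0 <= D ^+ 2 / delta.
Proof. by rewrite divr_ge0 ?sqr_ge0 // ltW. Qed.
Let t3 : 0 <= 27 * relation_cst 3 ^+ 2 * mu * (mu / delta + rho).
Proof.
by rewrite !mulr_ge0 ?sqr_ge0 ?addr_ge0 ?divr_ge0 // ltW.
Qed.
Let t4 : 0 <= 81 * relation_cst 4 ^+ 4 * mu * rho.
Proof. by rewrite !mulr_ge0 ?exprn_ge0 // ltW // (lt_le_trans _ C41). Qed.

(** Four coordinates of the points are related with coefficients of size about
    [rho]. *)
Lemma few_on_solid : (3 < \dim V)%N -> few_lines (fun x => Z x /\ bounded m x)
  (e * (81 * relation_cst 4 ^+ 4 * mu * rho)).
Proof.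
case: (red) => [r1 _ _ _ _] rV.
have rho4 : rho ^+ 4 = mu * rho by rewrite exprSr rho3.
have hl j : (j < 4)%N -> 1 <= (1 : R) <= (hgt (v j))%:R.
  move=> j4; rewrite lexx ler1n; have [] := r1 j (leq_trans j4 rV).
  by [].
apply: few_lines_le (@few_hyperplanes 4 (fun=> 1) (relation_cst 4 * rho) isT rV hl _ _).
- rewrite ler_wpM2l // big1 ?mulr1 // exprMn rho4.
  by rewrite le_eqVlt; apply/orP; left; apply/eqP; ring.
- by rewrite -[leLHS]mulr1 ler_pM.
rewrite big1 // mulr1 -/(relation_cst 4) /= exprMn rho3 ler_wpM2r ?(ltW mu0) //.
by rewrite exprS ler_peMr ?(le_trans _ C41) // exprn_ege1.
Qed.

(** The optimal coefficients have size about [(mu / A) ^ (1/2)], where the product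
    A of the heights is first lowered to [L]; the choice of [L] makes
    them at least 1 and at most a constant times [mu / delta + rho]. *)
Lemma few_on_plane : \dim V = 3 ->
  delta ^+ 2 / mu <= (\prod_(j < 3) hgt (v j))%N%:R ->
  few_lines (fun x => Z x /\ bounded m x)
    (e * (27 * relation_cst 3 ^+ 2 * mu * (mu / delta + rho))).
Proof.
move=> r3 hA; case: (red) => [r1 _ _ _ _].
set w := mu / delta + rho.
have w1 : 1 <= w by rewrite ler_wpDl // divr_ge0 // ltW.
have w0 : 0 < w by apply: lt_le_trans w1.
pose L := Num.max 1 (mu / w ^+ 2).
have L1 : 1 <= L by rewrite le_max lexx.
have L0 : 0 < L by apply: lt_le_trans L1.
have h1 j : (j < 3)%N -> 1 <= ((hgt (v j))%:R : R).
  by move=> j3; rewrite ler1n; have [] := r1 j; rewrite ?r3.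
have LA : L <= \prod_(j < 3) ((hgt (v j))%:R : R).
  rewrite ge_max; apply/andP; split.
    apply: (big_ind (fun x => 1 <= x)) => // [x y x1 y1|j _]; last exact: h1.
    by rewrite -[leLHS]mulr1 ler_pM.
  rewrite -natr_prod; apply: le_trans hA.
  have -> : delta ^+ 2 / mu = mu / (mu / delta) ^+ 2.
    by field; rewrite !gt_eqF.
  rewrite ler_wpM2l ?(ltW mu0) // lef_pV2 ?posrE ?exprn_gt0 ?divr_gt0 //.
  by rewrite lerXn2r ?nnegrE ?divr_ge0 ?(ltW mu0) ?(ltW delta0) ?(ltW w0) // lerDl ltW.
have [l [hl lL]] := split_product h1 L1 LA.
pose s := Num.sqrt (relation_cst 3 * mu / L).
have q0 : 0 <= relation_cst 3 * mu / L by rewrite divr_ge0 ?mulr_ge0 ?(le_trans _ C31) // ltW.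
have s2 : s ^+ 2 * L = relation_cst 3 * mu by rewrite sqr_sqrtr // divfK // gt_eqF.
have Lmu : L <= mu.
  rewrite ge_max mu1 /= ler_pdivrMr ?exprn_gt0 // ler_peMr ?(ltW mu0) //.
  by rewrite exprn_ege1.
have s1 : 1 <= s.
  rewrite -sqrtr1 ler_wsqrtr // ler_pdivlMr // mul1r; apply: le_trans Lmu _.
  by rewrite ler_peMl // ltW.
have sw : s <= relation_cst 3 * w.
  rewrite -(ler_pXn2r (n := 2)) // ?nnegrE ?sqrtr_ge0 ?mulr_ge0 ?(ltW w0) ?(le_trans _ C31) //.
  rewrite sqr_sqrtr // ler_pdivrMr // exprMn.
  have h : mu <= w ^+ 2 * L.
    by rewrite mulrC -ler_pdivrMr ?exprn_gt0 // le_max lexx orbT.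
  apply: le_trans (_ : relation_cst 3 ^+ 2 * mu <= _).
    rewrite ler_wpM2r ?(ltW mu0) // expr2 ler_peMr // (le_trans _ C31) //.
  by rewrite -[leRHS]mulrA ler_wpM2l // sqr_ge0.
have h33 : (3 <= \dim V)%N by rewrite r3.
apply: few_lines_le (@few_hyperplanes 3 l s isT h33 hl s1 _).
  have -> : 3 ^+ 3 * s ^+ 3 * \prod_(j < 3) l j = 27 * (relation_cst 3 * mu * s).
    by rewrite lL -s2; ring.
  have -> : 27 * relation_cst 3 ^+ 2 * mu * w =
      27 * (relation_cst 3 * mu * (relation_cst 3 * w)) by ring.
  rewrite ler_wpM2l // ler_wpM2l // ler_wpM2l ?mulr_ge0 ?(ltW mu0) //.
by rewrite lL /= s2.
Qed.

(** The points on lines and planes with small product of heights are left out;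
    they are counted for all components together. *)
Lemma few_on_component : few_lines (fun x => [/\ Z x, bounded m x,
    ~ small_tuple_point 2 delta x & ~ small_tuple_point 3 (delta ^+ 2 / mu) x])
  (e * generic_bound).
Proof.
case: (red) => [r1 r2 r3 r4 r5].
have G1 : 1 <= generic_bound by rewrite /generic_bound; move: t2 t3 t4; lra.
have eG : e <= e * generic_bound by rewrite ler_peMr.
have [[j [jV hj]]|tall] := pselect (exists j, (j < \dim V)%N /\ (m < hgt (v j))%N).
  apply: few_lines_le eG _; apply: few_lines_sub (few_if_tall jV hj) => x _ [].
  by [].
have hv j : (j < \dim V)%N -> (0 < hgt (v j) <= m)%N.
  move=> jV; have [_ ->] := r1 j jV; rewrite leqNgt; apply/negP => h.
  by apply: tall; exists j.
have eG1 : 1 <= e * generic_bound by rewrite -[leLHS]mulr1 ler_pM.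
have [dV|dV|dV] := ltngtP (\dim V) 2.
- apply: few_lines_le eG1 _.
  apply: few_lines_sub (@few_lines_list R N [:: toQ (v 0%N)]) => x nx [Zx _ _ _].
  exists (toQ (v 0%N)); first by rewrite inE.
  move: (r3 x (ZV Zx)) nx; case: (\dim V) dV => [|[|//]] _ xE.
    by rewrite xE big_ord0 eqxx.
  rewrite xE big_ord1 scaler_eq0 negb_or => /andP[c0 _].
  by rewrite line_scale.
- move: dV; rewrite leq_eqVlt => /orP[/eqP dV|dV].
    have [hA|hA] := leP (\prod_(j < 3) hgt (v j))%N%:R (delta ^+ 2 / mu).
      apply: few_lines0 => [|x _ [Zx bx _ ns]]; first exact: le_trans eG1.
      apply: ns; exists v; split=> // [j j3|]; first by rewrite hv // -dV.
      by rewrite dV; exact: in_box_of_bounded.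
    apply: few_lines_le (few_lines_sub _ (few_on_plane (esym dV) (ltW hA))).
      by rewrite ler_wpM2l // /generic_bound; move: t2 t3 t4; lra.
    by move=> x _ [].
  apply: few_lines_le (few_lines_sub _ (few_on_solid dV)).
    by rewrite ler_wpM2l // /generic_bound; move: t2 t3 t4; lra.
  by move=> x _ [].
have [hA|hA] := leP (\prod_(j < 2) hgt (v j))%N%:R delta.
  apply: few_lines0 => [|x _ [Zx bx ns _]]; first exact: le_trans eG1.
  apply: ns; exists v; split=> // [j j2|]; first by rewrite hv // dV.
  by rewrite -dV; exact: in_box_of_bounded.
have hv2 j : (j < 2)%N -> (0 < hgt (v j) <= m)%N by rewrite -dV; exact: hv.
apply: (@few_lines_le R N _ (D ^+ 2 / delta)).
  rewrite -[leLHS]mul1r ler_pM // /generic_bound; move: t2 t3 t4; lra.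
apply: few_lines_le (few_lines_sub _ (@few_lines_in_box R N K 2 m v K0 _)).
- apply: le_trans (box_size_le hv2) _; rewrite ler_wpM2l ?sqr_ge0 //.
  by rewrite lef_pV2 ?posrE ?(lt_trans delta0 hA) ?(ltW hA).
- by move=> x _ [Zx bx _ _]; rewrite -dV; exact: in_box_of_bounded.
by move=> j /hv2/andP[].
Qed.

End Component.
End Count.

(** * The exponents *)
Lemma powR_ge1 (R : realType) (a x : R) : 1 <= a -> 0 <= x -> 1 <= a `^ x.
Proof. by move=> a1 x0; rewrite -(powRr0 a) ler_powR. Qed.

Definition rho (R : realType) (mu : R) : R := mu `^ (3^-1).

Lemma rho_cube (R : realType) (mu : R) : 1 <= mu -> rho mu ^+ 3 = mu.
Proof.
move=> mu1; have mu0 : 0 <= mu by apply: le_trans mu1.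
by rewrite -powR_mulrn ?powR_ge0 // -powRrM mulVf ?pnatr_eq0 // powRr1.
Qed.

Lemma rho_ge1 (R : realType) (mu : R) : 1 <= mu -> 1 <= rho mu.
Proof. by move=> mu1; rewrite powR_ge1 ?invr_ge0. Qed.

Section Exponents.
Variables (R : realType) (n : nat) (d : R).
Hypotheses (hn : (3 <= n)%N) (d1 : 1 <= d).

Definition alpha : R := (3 * (n%:R - 1)) / (3 * n%:R - 1).
Let dalpha : R := d `^ alpha.
(** The factor by which the trivial bound [d] exceeds the bound to be proved. *)
Definition delta : R := d `^ (1 - alpha).

Let nR : 3 <= n%:R :> R. Proof. by rewrite ler_nat. Qed.
Let d0 : 0 < d. Proof. exact: lt_le_trans d1. Qed.
Let n1E : (3 * n - 1)%N%:R = 3 * n%:R - 1 :> R.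
Proof. by rewrite natrB ?natrM // muln_gt0 (leq_trans _ hn). Qed.
Let nz : 3 * n%:R - 1 != 0 :> R.
Proof. by rewrite gt_eqF //; move: nR; lra. Qed.

Lemma alpha_le1 : alpha <= 1.
Proof. by rewrite ler_pdivrMr; move: nR; lra. Qed.

Lemma alpha_ge0 : 0 <= alpha.
Proof. by rewrite divr_ge0; move: nR; lra. Qed.

Lemma delta_ge1 : 1 <= delta.
Proof. by rewrite powR_ge1 // subr_ge0 alpha_le1. Qed.

Lemma dalpha_delta : dalpha * delta = d.
Proof.
by rewrite -powRD ?(gt_eqF d0) ?implybT // addrC subrK powRr1 // ltW.
Qed.

Lemma dalpha_pow : dalpha ^+ (3 * n - 1) = d ^+ (3 * (n - 1)).
Proof.
rewrite -!powR_mulrn ?powR_ge0 ?(ltW d0) // -powRrM n1E; congr (_ `^ _).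
by rewrite natrM natrB ?(leq_trans _ hn) // divfK.
Qed.

Lemma delta_pow : delta ^+ (3 * n - 1) = d ^+ 2.
Proof.
rewrite -!powR_mulrn ?powR_ge0 ?(ltW d0) // -powRrM n1E; congr (_ `^ _).
by rewrite mulrBl mul1r divfK //; ring.
Qed.

Lemma delta_exp_le : delta ^+ n <= dalpha.
Proof.
have dl0 : 0 < delta by apply: lt_le_trans delta_ge1.
rewrite -(ler_pM2r dl0) dalpha_delta -exprSr.
rewrite -(ler_pXn2r (n := 2)) ?nnegrE ?exprn_ge0 ?(ltW dl0) ?(ltW d0) //.
by rewrite -delta_pow -exprM ler_weXn2l ?delta_ge1 //; lia.
Qed.

Section Height.
Variable mu : R.
Hypothesis mu1 : 1 <= mu.
Let mu0 : 0 < mu. Proof. exact: lt_le_trans mu1. Qed.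

Section SmallDegree.
Hypothesis small : d ^+ 3 <= mu ^+ (3 * n - 1).

Lemma delta_cube_le : delta ^+ 3 <= mu ^+ 2.
Proof.
have n0 : (0 < 3 * n - 1)%N by lia.
rewrite -(ler_pXn2r n0) ?nnegrE ?exprn_ge0 ?powR_ge0 ?(ltW mu0) //.
have -> : (delta ^+ 3) ^+ (3 * n - 1) = (d ^+ 3) ^+ 2.
  by rewrite exprAC delta_pow exprAC.
have -> : (mu ^+ 2) ^+ (3 * n - 1) = (mu ^+ (3 * n - 1)) ^+ 2 by rewrite exprAC.
by rewrite lerXn2r ?nnegrE ?exprn_ge0 ?(ltW d0) ?(ltW mu0).
Qed.

Lemma delta_le_rho : delta <= rho mu ^+ 2.
Proof.
rewrite -(ler_pXn2r (n := 3)) ?nnegrE ?exprn_ge0 ?powR_ge0 //.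
by rewrite exprAC rho_cube // delta_cube_le.
Qed.

Lemma degree_rho_le : d * (mu * rho mu) <= dalpha * mu ^+ 2.
Proof.
rewrite -dalpha_delta -mulrA ler_wpM2l ?powR_ge0 //.
rewrite mulrCA expr2 ler_wpM2l ?(ltW mu0) // -[leRHS](rho_cube mu1) exprSr.
by rewrite ler_wpM2r ?powR_ge0 // delta_le_rho.
Qed.

(** Multiplied by [delta] and squared this reads
    delta^(n+3) <= mu^(2n-2), which follows from delta^3 <= mu^2 if n >= 3. *)
Lemma plane_exp_le : mu * (delta ^+ 2 / mu) ^+ n <= dalpha.
Proof.
have dl1 := delta_ge1; have dl0 : 0 < delta by apply: lt_le_trans dl1.
have nE : n = n.-1.+1 by rewrite prednK // (leq_trans _ hn).
have -> : mu * (delta ^+ 2 / mu) ^+ n = delta ^+ (2 * n) / mu ^+ n.-1.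
  rewrite expr_div_n -exprM {2}nE exprS invfM mulrCA; congr (_ * _).
  by rewrite mulrA divff ?mul1r // gt_eqF.
rewrite ler_pdivrMr ?exprn_gt0 // -(ler_pM2r dl0) mulrAC dalpha_delta -exprSr.
rewrite -(ler_pXn2r (n := 2)) ?nnegrE ?mulr_ge0 ?exprn_ge0 ?(ltW d0) ?(ltW dl0) ?(ltW mu0) //.
rewrite exprMn -delta_pow -!exprM.
have -> : ((2 * n).+1 * 2 = (3 * n - 1) + (n + 3))%N by lia.
rewrite exprD ler_wpM2l ?exprn_ge0 ?(ltW dl0) //.
rewrite -(ler_pXn2r (n := 3)) ?nnegrE ?exprn_ge0 ?(ltW mu0) ?(ltW dl0) //.
rewrite exprAC; apply: le_trans (_ : (mu ^+ 2) ^+ (n + 3) <= _).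
  by rewrite lerXn2r ?nnegrE ?exprn_ge0 ?(ltW mu0) ?(ltW dl0) // delta_cube_le.
by rewrite -!exprM ler_weXn2l //; lia.
Qed.

End SmallDegree.

Lemma large_degree : mu ^+ (3 * n - 1) <= d ^+ 3 -> mu ^+ n.-1 <= dalpha.
Proof.
move=> large; have n0 : (0 < 3 * n - 1)%N by lia.
rewrite -(ler_pXn2r n0) ?nnegrE ?exprn_ge0 ?powR_ge0 ?(ltW mu0) //.
rewrite dalpha_pow exprM [leLHS]exprAC [(n - 1)%N]subn1.
by rewrite lerXn2r ?nnegrE ?exprn_ge0 ?(ltW mu0) ?(ltW d0).
Qed.

End Height.
End Exponents.

Lemma few_lines_bounded (R : numDomainType) N m :
  few_lines (fun x : 'rV[rat]_N => bounded m x) (((2 * m).+1 ^ N)%N%:R : R).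
Proof.
have := @few_lines_list R N [seq toQ z | z <- box N m].
rewrite size_map size_box; apply: few_lines_sub => x _ [z -> hz].
by exists (toQ z) => //; apply: map_f; rewrite mem_box.
Qed.

Definition height_zeta (R : realType) n m : R :=
  \sum_(z <- box n.+1 m | z != 0) ((hgt z)%:R ^+ n.+1)^-1.

(** * Points on a curve *)
Lemma few_points_on_curve (R : realType) n K m (C : {pred (mpoly.mpoly n.+1 rat)}) d
    (delta rho : R) :
  (forall V : {vspace 'rV[rat]_n.+1}, exists v b, reduced K V v b) ->
  (0 < K)%N -> (0 < m)%N -> proj_curve C -> curve_degree C d ->
  1 <= delta -> 1 <= rho -> rho ^+ 3 = m%:R ->
  few_lines (fun x => in_zeros C x /\ bounded m x)
   (d%:R * generic_bound K m delta rho
    + (3 * K%:R ^+ 2 * m%:R) ^+ 2 * delta ^+ n * height_zeta R n m ^+ 2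
    + (3 * K%:R ^+ 2 * m%:R) ^+ 3 * (delta ^+ 2 / m%:R) ^+ n * height_zeta R n m ^+ 3).
Proof.
move=> red K0 m0 curveC degC delta1 rho1 rho3.
have [k [e [Z [V [dE e0 CZ ZV hZ]]]]] := curve_components R curveC degC.
have mu0 : (0 : R) < m%:R by rewrite ltr0n.
have t2 := @few_small_tuple_points R n K m K0 m0 2 delta (le_trans ler01 delta1).
have t3 : 0 <= delta ^+ 2 / m%:R by rewrite divr_ge0 ?sqr_ge0 // ltW.
have {}t3 := @few_small_tuple_points R n K m K0 m0 3 _ t3.
have comp i (_ : i \in enum 'I_k) :
    few_lines (fun x => [/\ Z i x, bounded m x, ~ small_tuple_point K m 2 delta x &
       ~ small_tuple_point K m 3 (delta ^+ 2 / m%:R) x])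
     ((e i)%:R * generic_bound K m delta rho).
  have [v [b r]] := red (V i).
  apply: (few_on_component K0 m0 r _ (ZV i) _ delta1 rho1 rho3).
    by rewrite ler1n.
  exact: hZ.
have := few_lines_setU (few_lines_setU (few_lines_bigU comp) t2) t3.
rewrite -mulr_suml big_enum -natr_sum -dE; apply: few_lines_sub => x nx [Cx bx].
have [h3|n3] := pselect (small_tuple_point K m 3 (delta ^+ 2 / m%:R) x); first by right.
left; have [h2|n2] := pselect (small_tuple_point K m 2 delta x); first by right.
left; have [i Zx] := CZ x nx Cx; exists i => //; by rewrite mem_enum.
Qed.

Section Total.
Variables (R : realType) (n K m : nat) (d : R).
Hypotheses (hn : (3 <= n)%N) (m0 : (0 < m)%N) (d1 : 1 <= d).
Let mu : R := m%:R.
Let k : R := K%:R.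
Let dl := delta n d.
Let rh := rho mu.
Let da := d `^ alpha R n.
Let S := height_zeta R n m.
Let ell := 1 + ln mu.

Definition zeta_cst : R := (2 * n.+1 * 3 ^ n)%N%:R.
Definition generic_cst : R :=
  1 + 9 * k ^+ 4 + 27 * relation_cst R K 3 ^+ 2 + 81 * relation_cst R K 4 ^+ 4.
Definition total_cst : R :=
  2 * generic_cst + 9 * k ^+ 4 * zeta_cst ^+ 2 + 27 * k ^+ 6 * zeta_cst ^+ 3.

Let mu1 : 1 <= mu. Proof. by rewrite ler1n. Qed.
Let mu0 : 0 < mu. Proof. exact: lt_le_trans mu1. Qed.
Let d0 : 0 < d. Proof. exact: lt_le_trans d1. Qed.
Let dl1 : 1 <= dl. Proof. exact: delta_ge1. Qed.
Let dl0 : 0 < dl. Proof. exact: lt_le_trans dl1. Qed.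
Let rh1 : 1 <= rh. Proof. exact: rho_ge1. Qed.
Let rh0 : 0 <= rh. Proof. exact: le_trans rh1. Qed.
Let da0 : 0 <= da. Proof. exact: powR_ge0. Qed.
Let ell1 : 1 <= ell. Proof. by rewrite lerDl ln_ge0. Qed.
Let ell0 : 0 <= ell. Proof. exact: le_trans ell1. Qed.
Let k0 : 0 <= k. Proof. exact: ler0n. Qed.
Let z0 : 0 <= zeta_cst. Proof. exact: ler0n. Qed.
Let c30 : 0 <= relation_cst R K 3. Proof. exact: ler0n. Qed.
Let c40 : 0 <= relation_cst R K 4. Proof. exact: ler0n. Qed.

Let S0 : 0 <= S.
Proof. by apply: sumr_ge0 => z _; rewrite invr_ge0 exprn_ge0. Qed.

Let S_le : S <= zeta_cst * ell. Proof. exact: height_sum. Qed.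

Let main := da * mu ^+ 2 * ell ^+ 3.

Let main0 : 0 <= da * mu ^+ 2. Proof. by rewrite mulr_ge0 ?sqr_ge0. Qed.

Let le_main x : x <= da * mu ^+ 2 -> x <= main.
Proof. by move=> h; apply: le_trans h _; rewrite ler_peMr // exprn_ege1. Qed.

Lemma generic_cst_ge0 : 0 <= generic_cst.
Proof. by rewrite !addr_ge0 // ?mulr_ge0 ?exprn_ge0. Qed.

Lemma generic_bound_le :
  generic_bound K m dl rh <= generic_cst * (mu ^+ 2 / dl + mu * rh).
Proof.
rewrite /generic_bound /generic_cst -/mu -/k.
set x := mu ^+ 2 / dl; set y := mu * rh.
have x0 : 0 <= x by rewrite divr_ge0 ?sqr_ge0 // ltW.
have y1 : 1 <= y by rewrite -[leLHS]mulr1 ler_pM.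
have -> : (3 * k ^+ 2 * mu) ^+ 2 / dl = 9 * k ^+ 4 * x by rewrite /x; ring.
have -> : 27 * relation_cst R K 3 ^+ 2 * mu * (mu / dl + rh) =
    27 * relation_cst R K 3 ^+ 2 * (x + y).
  by rewrite /x /y; ring.
have -> : 81 * relation_cst R K 4 ^+ 4 * mu * rh =
    81 * relation_cst R K 4 ^+ 4 * y by rewrite /y; ring.
have : 0 <= 9 * k ^+ 4 by rewrite mulr_ge0 ?exprn_ge0.
have : 0 <= 27 * relation_cst R K 3 ^+ 2 by rewrite mulr_ge0 ?exprn_ge0.
have : 0 <= 81 * relation_cst R K 4 ^+ 4 by rewrite mulr_ge0 ?exprn_ge0.
move: (9 * _) (27 * _) (81 * _) => a b c c1 b1 a1; nra.
Qed.

Lemma total_le : d ^+ 3 <= mu ^+ (3 * n - 1) ->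
  d * generic_bound K m dl rh
    + (3 * k ^+ 2 * mu) ^+ 2 * dl ^+ n * S ^+ 2
    + (3 * k ^+ 2 * mu) ^+ 3 * (dl ^+ 2 / mu) ^+ n * S ^+ 3
  <= total_cst * main.
Proof.
move=> small; rewrite /total_cst 2!(mulrDl _ _ main).
apply: lerD; first apply: lerD.
- apply: le_trans (ler_wpM2l (ltW d0) generic_bound_le) _.
  rewrite [leRHS]mulrAC [leRHS]mulrC mulrCA ler_wpM2l ?generic_cst_ge0 //.
  rewrite mulrDr (mulr_natl main 2) mulr2n; apply: lerD; apply: le_main.
    rewrite -(dalpha_delta n d1) -/dl -/da -mulrA [dl * _]mulrC divfK //.
    by rewrite gt_eqF.
  exact: degree_rho_le.
- have h := delta_exp_le hn d1; rewrite -/dl -/da in h.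
  have S2 : S ^+ 2 <= zeta_cst ^+ 2 * ell ^+ 3.
    apply: le_trans (_ : (zeta_cst * ell) ^+ 2 <= _).
      by rewrite lerXn2r ?nnegrE ?mulr_ge0.
    by rewrite exprMn ler_wpM2l ?exprn_ge0 // ler_weXn2l.
  have -> : 9 * k ^+ 4 * zeta_cst ^+ 2 * main =
      9 * k ^+ 4 * mu ^+ 2 * da * (zeta_cst ^+ 2 * ell ^+ 3) by rewrite /main; ring.
  have -> : (3 * k ^+ 2 * mu) ^+ 2 = 9 * k ^+ 4 * mu ^+ 2 by ring.
  have c0 : 0 <= 9 * k ^+ 4 * mu ^+ 2 by rewrite !mulr_ge0 ?exprn_ge0 ?(ltW mu0).
  apply: ler_pM S2; rewrite ?exprn_ge0 //; last exact: (ler_wpM2l c0 h).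
  by apply: mulr_ge0 c0 _; rewrite exprn_ge0 // ltW.
have h := plane_exp_le hn d1 mu1 small; rewrite -/dl -/da in h.
have S3 : S ^+ 3 <= zeta_cst ^+ 3 * ell ^+ 3.
  by rewrite -exprMn lerXn2r ?nnegrE ?mulr_ge0.
have -> : 27 * k ^+ 6 * zeta_cst ^+ 3 * main =
    27 * k ^+ 6 * mu ^+ 2 * da * (zeta_cst ^+ 3 * ell ^+ 3) by rewrite /main; ring.
have -> : (3 * k ^+ 2 * mu) ^+ 3 * (dl ^+ 2 / mu) ^+ n =
    27 * k ^+ 6 * mu ^+ 2 * (mu * (dl ^+ 2 / mu) ^+ n) by ring.
have q0 : 0 <= mu * (dl ^+ 2 / mu) ^+ n.
  by rewrite mulr_ge0 ?exprn_ge0 ?divr_ge0 ?exprn_ge0 ?(ltW mu0) ?(ltW dl0).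
have c0 : 0 <= 27 * k ^+ 6 * mu ^+ 2 by rewrite !mulr_ge0 ?exprn_ge0 ?(ltW mu0).
apply: ler_pM S3; rewrite ?exprn_ge0 //; last exact: (ler_wpM2l c0 h).
exact: mulr_ge0.
Qed.

Lemma total_cst_ge0 : 0 <= total_cst.
Proof.
by rewrite !addr_ge0 // !mulr_ge0 ?exprn_ge0 ?generic_cst_ge0.
Qed.

Lemma trivial_le : mu ^+ (3 * n - 1) <= d ^+ 3 ->
  ((2 * m).+1 ^ n.+1)%N%:R <= 3 ^+ n.+1 * main.
Proof.
move=> large; have h := large_degree hn d1 mu1 large; rewrite -/da in h.
rewrite natrX; apply: le_trans (_ : (3 * mu) ^+ n.+1 <= _).
  rewrite lerXn2r ?nnegrE ?mulr_ge0 ?(ltW mu0) // -natr1 natrM.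
  by move: mu1; rewrite /mu; lra.
rewrite exprMn ler_wpM2l ?exprn_ge0 //; apply: le_main.
have -> : mu ^+ n.+1 = mu ^+ n.-1 * mu ^+ 2.
  by rewrite -exprD addn2 prednK // (leq_trans _ hn).
by rewrite ler_wpM2r ?sqr_ge0.
Qed.

End Total.

Lemma count_le (R : realType) n (C : {pred (mpoly.mpoly n.+1 rat)}) (B b : R) :
  few_lines (fun x => in_zeros C x /\ bounded (Num.truncn B) x) b ->
  (count_rational_points C B)%:R <= b.
Proof.
move=> few; apply: few; first exact: fset_uniq.
move=> L; rewrite in_fset_set; last exact: finite_rational_points.
move=> /set_mem[x [nx hx zx ->]]; exists (toQ x); split=> //.
  by rewrite toQ_eq0.
split=> //; exists x => //; apply/hgtP => i.
have B0 : 0 <= B by apply: le_trans (hx i); rewrite ler0z.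
by rewrite truncn_ge_nat // natr_absz.
Qed.

Theorem proposition3p9 (R : realType) (n : nat) (hn : (3 <= n)%N) :
  exists c kappa : R,
    forall (d : nat) (C : {pred (mpoly.mpoly n.+1 rat)}) (B : R),
      (1 <= d)%N -> proj_curve C -> curve_degree C d -> 2 <= B ->
      (count_rational_points C B)%:R <=
        c * (d%:R `^ ((3 * (n%:R - 1)) / (3 * n%:R - 1))) * B ^+ 2
          * (ln B `^ kappa).
Proof.
have [K K0 red] := reduced_basis n.+1.
pose c0 : R := total_cst R n K + 3 ^+ n.+1.
pose cl : R := 1 + (ln 2)^-1.
exists (c0 * cl ^+ 3), 3%:R => d C B d1 curveC degC B2.
have d1R : 1 <= d%:R :> R by rewrite ler1n.
have B0 : 0 <= B by apply: le_trans B2.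
pose m := Num.truncn B; pose mu : R := m%:R.
have m2 : (2 <= m)%N by rewrite truncn_ge_nat.
have m0 : (0 < m)%N by apply: leq_trans m2.
have mu1 : 1 <= mu by rewrite ler1n.
have mu0 : 0 < mu by rewrite ltr0n.
have muB : mu <= B by rewrite truncn_le.
have t0 := total_cst_ge0 R n K.
pose da : R := d%:R `^ alpha R n.
have da0 : 0 <= da by apply: powR_ge0.
have ell0 : 0 <= 1 + ln mu by rewrite addr_ge0 // ln_ge0.
have main0 : 0 <= da * mu ^+ 2 * (1 + ln mu) ^+ 3.
  by rewrite !mulr_ge0 ?exprn_ge0 // ltW.
have step : (count_rational_points C B)%:R <= c0 * (da * mu ^+ 2 * (1 + ln mu) ^+ 3).
  have [small|large] := leP ((d%:R : R) ^+ 3) (mu ^+ (3 * n - 1)).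
    apply: le_trans (count_le (few_points_on_curve red K0 m0 curveC degC
      (delta_ge1 hn d1R) (rho_ge1 mu1) (rho_cube mu1))) _.
    apply: le_trans (total_le K hn m0 d1R small) _.
    by rewrite ler_wpM2r // lerDl exprn_ge0.
  apply: (@le_trans _ _ ((2 * m).+1 ^ n.+1)%N%:R).
    apply: count_le; apply: (few_lines_sub _ (@few_lines_bounded R n.+1 m)).
    by move=> x _ [].
  apply: le_trans (trivial_le hn m0 d1R (ltW large)) _.
  by rewrite ler_wpM2r // lerDr.
apply: le_trans step _.
have ln2 : 0 < ln 2 :> R by rewrite ln_gt0 // ltr1n.
have Bp : 0 < B by apply: lt_le_trans B2.
have lnB : ln 2 <= ln B by rewrite ler_ln ?posrE.
rewrite powR_mulrn; last by apply: le_trans lnB; apply: ltW.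
have -> : c0 * cl ^+ 3 * d%:R `^ (3 * (n%:R - 1) / (3 * n%:R - 1)) * B ^+ 2 * ln B ^+ 3
    = c0 * (da * B ^+ 2 * (cl * ln B) ^+ 3) by rewrite /da /alpha exprMn; ring.
have c00 : 0 <= c0 by rewrite /c0 addr_ge0 ?exprn_ge0.
rewrite ler_wpM2l //.
apply: ler_pM; rewrite ?exprn_ge0 ?mulr_ge0 ?(ltW mu0) //.
  by rewrite ler_wpM2l // lerXn2r ?nnegrE ?(ltW mu0).
have muln : ln mu <= ln B by rewrite ler_ln ?posrE.
rewrite lerXn2r ?nnegrE //.
  by rewrite mulr_ge0 // ?addr_ge0 ?invr_ge0 ?(ltW ln2) // (le_trans _ lnB) // ltW.
rewrite /cl mulrDl mul1r addrC lerD // mulrC ler_pdivlMr // mul1r //.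
Qed.
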